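(* Let $r,s\ge0$ be integers, let $a,b$ be distinct corners of $B_{r,s}=P_3^{\square r}\square Q_s$, assume that $H=B_{r,s}-\{a,b\}$ is nonempty, and put $p=p(a,b)$, $q=q(a,b)$. Then: (1) $H$ is a partial cube if and only if either $(p,q)\ne(0,2)$, or $(p,q)=(0,2)$ and $r+s=3$; (2) if $H$ is a partial cube, then it is a daisy cube if and only if $q=0$ or $(p,q)=(0,1)$; (3) $H$ is a minimal forbidden pc-minor for daisy cubes if and only if $a,b$ are opposite corners, $s\ge1$, and $2r+s\ge3$.
   Context: Graphs are finite and simple; partial cubes are connected by convention. $P_3$ is the path on three vertices, $Q_s$ the hypercube on $\{0,1\}^s$, $\square$ the Cartesian product, $G^{\square0}=Q_0=K_1$. Coordinate model: $V(B_{r,s})=\{0,1,2\}^r\times\{0,1\}^s$, two vertices being adjacent iff they differ in exactly one coordinate and there by exactly $1$. A corner is a vertex whose first $r$ coordinates all lie in $\{0,2\}$. For corners $a,b$: $p(a,b)=|\{i\in[r]:\{a_i,b_i\}=\{0,2\}\}|$ and $q(a,b)=|\{j\in[s]:a_{r+j}\ne b_{r+j}\}|$. Two corners are opposite if $p=r$ and $q=s$. $B_{r,s}-\{a,b\}$ is the subgraph induced by the remaining vertices. A partial cube is a graph isomorphic to an isometric (distance-preserving) subgraph of a hypercube. A daisy cube is a graph isomorphic to the induced subgraph $Q_n[D]$ for some $n\ge0$ and nonempty down-set $D\subseteq\{0,1\}^n$ (coordinatewise order). In a partial cube, $ab\,\Theta\,uv$ iff $d(a,u)+d(b,v)\ne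 d(a,v)+d(b,u)$; this is an equivalence relation on edges, and each class ($\Theta$-class) determines two complementary halfspaces $\{z:d(a,z)<d(b,z)\}$, $\{z:d(b,z)<d(a,z)\}$. A restriction of a partial cube is the subgraph induced by a halfspace of a $\Theta$-class; a contraction is obtained by contracting all edges of one $\Theta$-class (suppressing loops and parallel edges). A pc-minor is any graph obtained by a finite sequence of restrictions and contractions; it is proper if not isomorphic to the original graph. A minimal forbidden pc-minor for daisy cubes is a partial cube that is not a daisy cube but all of whose proper pc-minors are daisy cubes. *)

(* Defs.v *)
From mathcomp Require Import all_boot.

Set Implicit Arguments.
Unset Strict Implicit.
Unset Printing Implicit Defensive.

Record graph := Graph {
  vertex :> finType;
  adj : rel vertex;
  adj_sym : symmetric adj;
  adj_irrefl : irreflexive adj }.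

Definition iso (G H : graph) : Prop :=
  exists f : G -> H, bijective f /\ forall x y, adj (f x) (f y) = adj x y.

Section Induced.
Variables (G : graph) (S : {set G}).

Definition induced_adj : rel {x : G | x \in S} :=
  fun x y => adj (val x) (val y).

Fact induced_sym : symmetric induced_adj.
Proof. by move=> x y; rewrite /induced_adj adj_sym. Qed.

Fact induced_irrefl : irreflexive induced_adj.
Proof. by move=> x; rewrite /induced_adj adj_irrefl. Qed.

Definition induced : graph := Graph induced_sym induced_irrefl.
End Induced.

Definition connected (G : graph) : Prop :=
  0 < #|G| /\ forall x y : G, connect (@adj G) x y.

Definition walk (G : graph) (n : nat) (x y : G) : bool :=
  [exists p : n.-tuple G, path (@adj G) x p && (last x p == y)].

(* A shortest walk has length less than #|G|, so this is the usual graph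
   distance on every component; vertices in distinct components get the junk
   value #|G|, hence the explicit connectedness in [partial_cube]. *)
Definition dist (G : graph) (x y : G) : nat :=
  find (fun n => walk n x y) (iota 0 #|G|).

Section Hypercube.
Variable n : nat.

Definition cube_adj : rel {ffun 'I_n -> bool} :=
  fun x y => #|[set i | x i != y i]| == 1.

Fact cube_sym : symmetric cube_adj.
Proof.
move=> x y; rewrite /cube_adj; congr (_ == _); apply: eq_card => i.
by rewrite !inE eq_sym.
Qed.

Fact cube_irrefl : irreflexive cube_adj.
Proof.
move=> x; rewrite /cube_adj (_ : [set _ | _] = set0) ?cards0 //.
by apply/setP => i; rewrite !inE eqxx.
Qed.

Definition Q : graph := Graph cube_sym cube_irrefl.
End Hypercube.

(* A subgraph preserving the distances of the ambient graph preserves adjacency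
   both ways, so isometric subgraphs are given by their vertex sets. *)
Definition isometric (G : graph) (S : {set G}) : Prop :=
  forall x y : induced S, dist x y = dist (val x) (val y).

Definition partial_cube (G : graph) : Prop :=
  connected G /\
  exists (n : nat) (S : {set Q n}), isometric S /\ iso G (induced S).

Definition down_set (n : nat) (D : {set Q n}) : Prop :=
  forall x y : {ffun 'I_n -> bool},
    x \in D -> (forall i, y i <= x i) -> y \in D.

Definition daisy_cube (G : graph) : Prop :=
  exists (n : nat) (D : {set Q n}),
    [/\ D != set0, down_set D & iso G (induced D)].

Section Minors.
Variable G : graph.

(* Meant for edges ab and uv; it does not depend on their orientations. *)
Definition Theta (a b u v : G) : bool :=
  dist a u + dist b v != dist a v + dist b u.

Definition halfspace (u v : G) : {set G} := [set z | dist u z < dist v z].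

Definition restriction (u v : G) : graph := induced (halfspace u v).

Variables u v : G.

Definition Theta_edge : rel G := fun x y => adj x y && Theta x y u v.

Definition contraction_vertex : finType :=
  {A : {set G} | A \in equivalence_partition (connect Theta_edge) [set: G]}.

Definition contraction_adj : rel contraction_vertex :=
  fun A B => (A != B) && [exists x in val A, exists y in val B, adj x y].

Fact contraction_sym : symmetric contraction_adj.
Proof.
move=> A B; rewrite /contraction_adj eq_sym; congr (_ && _).
by apply/exists_inP/exists_inP => -[x xA /exists_inP[y yB xy]];
  exists y => //; apply/exists_inP; exists x => //; rewrite adj_sym.
Qed.

Fact contraction_irrefl : irreflexive contraction_adj.
Proof. by move=> A; rewrite /contraction_adj eqxx. Qed.

Definition contraction : graph := Graph contraction_sym contraction_irrefl.
End Minors.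

(* A class is represented by one of its edges uv; its two halfspaces are
   [halfspace u v] and [halfspace v u]. *)
Inductive pc_minor (G : graph) : graph -> Prop :=
| pc_minor_refl : pc_minor G G
| pc_minor_restriction (H : graph) (u v : H) :
    pc_minor G H -> adj u v -> pc_minor G (restriction u v)
| pc_minor_contraction (H : graph) (u v : H) :
    pc_minor G H -> adj u v -> pc_minor G (contraction u v).

Definition minimal_forbidden (G : graph) : Prop :=
  [/\ partial_cube G, ~ daisy_cube G &
      forall H : graph, pc_minor G H -> ~ iso H G -> daisy_cube H].

Section Grid.
Variables r s : nat.

Definition grid_vertex : finType :=
  ({ffun 'I_r -> 'I_3} * {ffun 'I_s -> bool})%type.

Definition coord (x : grid_vertex) (k : 'I_r + 'I_s) : nat :=
  match k with inl i => x.1 i | inr j => x.2 j end.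

Definition grid_adj : rel grid_vertex := fun x y =>
  [exists k, [forall l, (coord x l != coord y l) == (l == k)]
             && ((coord x k == (coord y k).+1) || (coord y k == (coord x k).+1))].

Fact grid_sym : symmetric grid_adj.
Proof.
move=> x y; apply: eq_existsb => k; rewrite orbC; congr (_ && _).
by apply: eq_forallb => l; rewrite [coord x l == _]eq_sym.
Qed.

Fact grid_irrefl : irreflexive grid_adj.
Proof.
move=> x; apply/existsP => -[k /andP[/forallP/(_ k)]].
by rewrite !eqxx.
Qed.

Definition B : graph := Graph grid_sym grid_irrefl.

Definition corner (x : grid_vertex) : Prop :=
  forall i, x.1 i = 0 :> nat \/ x.1 i = 2 :> nat.

(* In 'I_3, [ord0] is 0 and [ord_max] is 2. *)
Definition p_corners (a b : grid_vertex) : nat :=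
  #|[set i | [set a.1 i; b.1 i] == [set ord0; ord_max]]|.

Definition q_corners (a b : grid_vertex) : nat :=
  #|[set j | a.2 j != b.2 j]|.

Definition opposite (a b : grid_vertex) : Prop :=
  p_corners a b = r /\ q_corners a b = s.

Definition B_minus (a b : B) : graph := induced (~: [set a; b]).
End Grid.

(* Main.v *)
Require Import Defs.
From mathcomp Require Import all_boot.
From mathcomp Require Import zify.

(** Embed the grid in a hypercube by giving each ternary coordinate two bits,
    one for each end of the path, the middle vertex having neither.  The grid
    becomes a family of sets of bits that is closed under taking subsets, and each
    corner is maximal in it for a suitable orientation of the binary coordinates.
    The three parts are then questions about this family with two members
    removed.

    Partial cubes.  A family of sets is isometric in the hypercube if one can
    always flip a bit towards a target without leaving the family
    ([cube_embedding]).  With two corners removed this only fails when the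
    corners differ in exactly two binary coordinates ([grid_step]): then two
    vertices at distance two lose both common neighbours.  In that case, if the
    corners share two further bits, a chain of squares forces any embedding to
    keep those two vertices at distance two, which is absurd ([no_two_common_bits]);
    if they share none, the graph is disconnected ([some_common_bit]); and if
    they share exactly one, which means that there are three coordinates, the two
    vertices are pendant and can be given bits of their own
    ([pendant_embedding]).

    Daisy cubes.  In any embedding, a daisy cube has a base vertex such that
    moving towards it never leaves the image ([daisy_base]), and conversely
    ([embedding_daisy]).  If two missing sets differ on a bit and flipping that
    bit at each of them gives vertices, there is no base ([not_daisy]).  A binary
    coordinate on which the corners differ is such a bit, except when the flip
    exchanges the corners; the pendant vertices provide another instance.  When
    there is no such coordinate, or the corners are adjacent, the removed corners
    form an up-set and the graph is daisy ([code_daisy]).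

    Minimality.  In coordinates a restriction fixes a bit and a contraction
    forgets one ([restriction_image], [contraction_image]).  If the corners
    differ on all bits, either operation leaves at most one missing corner, and a
    grid without one corner is daisy ([corner_slice_daisy]).  If they share a
    bit, fixing it gives a proper minor with the same obstruction
    ([nonopposite_minor]); in the exceptional case one contracts one of the two
    bits on which the corners differ ([pendant_contraction]). *)

Set Implicit Arguments.
Unset Strict Implicit.
Unset Printing Implicit Defensive.

(** * Sets of bits and graph distances *)

Section SymDiff.
Variable T : finType.
Implicit Types (A B C : {set T}) (k l : T).

Definition symd A B : {set T} := [set k | (k \in A) (+) (k \in B)].
Definition flip A k := symd A [set k].

Lemma in_symd A B k : (k \in symd A B) = (k \in A) (+) (k \in B).
Proof. by rewrite inE. Qed.

Lemma in_flip A k l : (l \in flip A k) = (l \in A) (+) (l == k).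
Proof. by rewrite !inE. Qed.

Lemma symdC A B : symd A B = symd B A.
Proof. by apply/setP=> k; rewrite !in_symd addbC. Qed.

Lemma symdA A B C : symd A (symd B C) = symd (symd A B) C.
Proof. by apply/setP=> k; rewrite !in_symd addbA. Qed.

Lemma symd_flip A B k : symd (flip A k) B = flip (symd A B) k.
Proof. by rewrite /flip -!symdA (symdC B). Qed.

Lemma symdK C A : symd (symd A C) C = A.
Proof. by apply/setP=> k; rewrite !in_symd addbK. Qed.

Lemma symd_translate C A B : symd (symd A C) (symd B C) = symd A B.
Proof. by rewrite (symdC A) -symdA (symdC A) symdA symdC (symdC C) symdK symdC. Qed.

Lemma flipK k A : flip (flip A k) k = A.
Proof. exact: symdK. Qed.

Lemma flipC A k l : flip (flip A k) l = flip (flip A l) k.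
Proof. by rewrite /flip -!symdA (symdC [set k]). Qed.

Lemma flip_inj A : injective (flip A).
Proof.
move=> k l /setP/(_ k); rewrite !in_flip eqxx => /addbI.
by move/esym/eqP.
Qed.

Lemma flip_neq A k : flip A k != A.
Proof. by apply/eqP=> /setP/(_ k); rewrite in_flip eqxx; case: (k \in A). Qed.

Lemma symd_eq0 A B : (symd A B == set0) = (A == B).
Proof.
apply/eqP/eqP=> [/setP e|->]; apply/setP=> k; last by rewrite in_symd addbb inE.
by move: (e k); rewrite in_symd inE; case: (k \in A) (k \in B) => -[].
Qed.

Lemma symdNeq A B : A != B -> exists k, k \in symd A B.
Proof. by rewrite -symd_eq0 => /set0Pn. Qed.

Lemma flip_rem A k : k \in A -> flip A k = A :\ k.
Proof.
move=> kA; apply/setP=> l; rewrite in_flip !inE.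
by case: eqP => [->|]; rewrite ?kA ?addbF.
Qed.

Lemma flip_add A k : k \notin A -> flip A k = k |: A.
Proof.
move=> kA; apply/setP=> l; rewrite in_flip !inE.
by case: eqP => [->|]; rewrite ?(negPf kA) ?addbF.
Qed.

Lemma card_flip A k : (k \in A) + #|flip A k| = (k \notin A) + #|A|.
Proof.
case: (boolP (k \in A)) => kA /=; last by rewrite flip_add // cardsU1 kA.
by rewrite flip_rem // [in RHS](cardsD1 k) kA.
Qed.

Lemma symd_flipl A k : symd (flip A k) A = [set k].
Proof.
apply/setP=> l; rewrite in_symd in_flip inE.
by case: (l \in A) (l == k) => [] [].
Qed.

Lemma symd_eq1 A B k : symd B A = [set k] -> B = flip A k.
Proof. by move=> e; rewrite /flip -e symdC symdK. Qed.

Lemma symd_injl C : injective (fun A => symd A C).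
Proof. by move=> A B e; rewrite -(symdK C A) e symdK. Qed.

Lemma symd_swap A B C D :
  symd A B = symd C D -> symd A C = symd B D.
Proof.
move/setP=> e; apply/setP=> k; move: (e k); rewrite !in_symd.
by case: (k \in A) (k \in B) (k \in C) (k \in D) => [] [] [] [].
Qed.

Definition hamming A B := #|symd A B|.

Lemma hammingC A B : hamming A B = hamming B A.
Proof. by rewrite /hamming symdC. Qed.

(** One equation without subtraction for both directions of the change, so that
    a case distinction and linear arithmetic settle its uses. *)
Lemma hamming_flip A B k :
  (k \in symd A B) + hamming (flip A k) B = (k \notin symd A B) + hamming A B.
Proof. by rewrite /hamming symd_flip card_flip. Qed.

Lemma hamming_flip1 A k : hamming A (flip A k) = 1.
Proof.
rewrite hammingC; have := hamming_flip A A k.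
have/eqP e0 : symd A A == set0 by rewrite symd_eq0.
by rewrite /hamming e0 inE cards0.
Qed.

Lemma hamming_eq0 A B : (hamming A B == 0) = (A == B).
Proof. by rewrite cards_eq0 symd_eq0. Qed.

End SymDiff.

Section Distance.
Variable G : graph.
Implicit Types x y : G.

Lemma walkP n x y :
  reflect (exists p, [/\ size p = n, path (@adj G) x p & last x p = y])
          (walk n x y).
Proof.
apply: (iffP existsP) => [[p /andP[pp /eqP lp]]|[p [sp pp lp]]].
  by exists p; rewrite size_tuple.
by rewrite -sp; exists (in_tuple p); rewrite pp lp eqxx.
Qed.

Lemma dist_eq n x y :
  walk n x y -> n < #|G| -> (forall m, walk m x y -> n <= m) -> dist x y = n.
Proof.
move=> wn ltn minn; rewrite /dist.
set w := fun m => walk m x y.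
have hw : has w (iota 0 #|G|) by apply/hasP; exists n; rewrite ?mem_iota.
have lt_d := hw; rewrite has_find size_iota in lt_d.
have wd := nth_find 0 hw; rewrite nth_iota // add0n in wd.
apply/eqP; rewrite eqn_leq (minn _ wd) andbT leqNgt; apply/negP=> /(before_find 0).
by rewrite nth_iota // /w wn.
Qed.

Lemma connect_short x y :
  connect (@adj G) x y -> exists2 n, walk n x y & n < #|G|.
Proof.
case/connectP=> p pp ->; case/shortenP: pp => p' pp' up' _.
exists (size p'); first by apply/walkP; exists p'.
by rewrite -[_ < _]/(size (x :: p') <= _) -(card_uniqP up') max_card.
Qed.

Lemma walk_dist x y : connect (@adj G) x y -> walk (dist x y) x y.
Proof.
case/connect_short=> n wn ltn; rewrite /dist.
set w := fun m => walk m x y.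
have hw : has w (iota 0 #|G|) by apply/hasP; exists n; rewrite ?mem_iota.
have lt_d := hw; rewrite has_find size_iota in lt_d.
by have := nth_find 0 hw; rewrite nth_iota.
Qed.

End Distance.

(** An isometric embedding into a hypercube, described without distances.
    Adjacency is a single flip, and from every vertex some neighbour is one
    flip closer to any prescribed target; the latter forces shortest walks to
    be as short as in the hypercube, see [embedding_dist].  The condition is
    easy to check on explicit families and is visibly inherited by halfspaces,
    which is why it replaces [isometric] throughout. *)
Definition cube_embedding (G : graph) (T : finType) (f : G -> {set T}) : Prop :=
  (forall x y, adj x y <-> exists k, f y = flip (f x) k) /\
  (forall x y, x != y ->
     exists k x', k \in symd (f x) (f y) /\ f x' = flip (f x) k).

Section Embedding.
Variables (G : graph) (T : finType) (f : G -> {set T}).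
Hypothesis emb : cube_embedding f.

Lemma embedding_inj : injective f.
Proof.
move=> x y exy; apply/eqP/negPn/negP=> /(proj2 emb)[k [x' []]].
by rewrite exy in_symd addbb.
Qed.

Lemma embedding_adj x y k : f y = flip (f x) k -> adj x y.
Proof. by move=> e; apply/(proj1 emb); exists k. Qed.

(** No walk beats the Hamming distance, because one edge changes one bit. *)
Lemma embedding_path x p :
  path (@adj G) x p -> hamming (f x) (f (last x p)) <= size p.
Proof.
elim: p x => [|y p IHp] x /=; first by rewrite leqn0 hamming_eq0.
case/andP=> /(proj1 emb)[k e] /IHp; rewrite e.
by have := hamming_flip (f x) (f (last y p)) k; case: (k \in _) => /=; lia.
Qed.

(** Greedy steps reach [y] after exactly Hamming-distance many edges. *)
Lemma embedding_geodesic x y : walk (hamming (f x) (f y)) x y.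
Proof.
apply/walkP; move: {2}(hamming _ _) (erefl (hamming (f x) (f y))) => n.
elim: n x => [|n IHn] x e.
  by move/eqP: e; rewrite hamming_eq0 => /eqP/embedding_inj <-; exists [::];
     rewrite /hamming; split=> //; apply/esym/eqP; rewrite cards_eq0 symd_eq0.
have [exy|/(proj2 emb)[k [x' [kxy ex']]]] := eqVneq x y.
  by move/eqP: e; rewrite exy; have/eqP -> : hamming (f y) (f y) == 0
     by rewrite hamming_eq0.
have := hamming_flip (f x) (f y) k; rewrite kxy -ex' e /= add1n add0n => -[e'].
have [p [sp pp lp]] := IHn _ e'; exists (x' :: p); split=> //=.
  by rewrite sp e'.
by rewrite (embedding_adj ex').
Qed.

Lemma embedding_dist x y : dist x y = hamming (f x) (f y).
Proof.
have minh m : walk m x y -> hamming (f x) (f y) <= m.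
  by case/walkP=> p [<- /embedding_path pp <-].
apply: dist_eq => //; first exact: embedding_geodesic.
have/walkP[p [_ pp lp]] := embedding_geodesic x y.
have /connect_short[n wn] : connect (@adj G) x y by apply/connectP; exists p.
exact/leq_ltn_trans/minh.
Qed.

Lemma embedding_connect x y : connect (@adj G) x y.
Proof.
by have/walkP[p [_ pp lp]] := embedding_geodesic x y; apply/connectP; exists p.
Qed.

End Embedding.

Lemma iso_sym G H : iso G H -> iso H G.
Proof.
case=> f [[g fK gK] fadj]; exists g; split; first by exists f.
by move=> x y; rewrite -fadj !gK.
Qed.

Lemma iso_card G H : iso G H -> #|G| = #|H|.
Proof. by case=> f [bf _]; apply: bij_eq_card bf. Qed.

Lemma iso_connected G H : iso G H -> connected G -> connected H.
Proof.
move=> iGH [G0 cG]; split; first by rewrite -(iso_card iGH).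
case: (iso_sym iGH) => g [[f gK fK] gadj] x y.
have/connectP[p pp lp] := cG (g x) (g y).
apply/connectP; exists (map f p); last by rewrite -[x]gK last_map -lp gK.
rewrite -[x]gK path_map; apply: sub_path pp => u v /=.
by rewrite -gadj !fK.
Qed.

Lemma embedding_iso (G H : graph) (T : finType) (f : H -> {set T}) (g : G -> H) :
  cube_embedding f -> bijective g -> (forall x y, adj (g x) (g y) = adj x y) ->
  cube_embedding (f \o g).
Proof.
move=> [fadj fgr] bg gadj; split=> x y; first by rewrite -gadj; exact: fadj.
rewrite -(inj_eq (bij_inj bg)) => /fgr[k [x' kx']]; exists k.
by case: bg => g' _ gK; exists (g' x'); rewrite /= gK.
Qed.

Lemma translate_embedding (G : graph) (T : finType) (f : G -> {set T}) Z :
  cube_embedding f -> cube_embedding (fun x => symd (f x) Z).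
Proof.
case=> fadj fgr; split=> x y.
  rewrite fadj; split=> -[k e]; exists k; first by rewrite e symd_flip.
  by rewrite -(symdK Z (f y)) e symd_flip symdK.
by case/fgr=> k [x' [kx' e]]; exists k, x'; rewrite symd_translate e symd_flip.
Qed.

Definition bits n (x : Q n) : {set 'I_n} := [set i | x i].

Lemma bits_inj n : injective (@bits n).
Proof. by move=> x y /setP e; apply/ffunP=> i; move: (e i); rewrite !inE. Qed.

Lemma cube_adjE n (x y : Q n) :
  adj x y <-> exists k, bits y = flip (bits x) k.
Proof.
have e : [set i | x i != y i] = symd (bits x) (bits y).
  by apply/setP=> i; rewrite !inE; case: (x i) (y i) => -[].
rewrite /adj /= /cube_adj e; split=> [/cards1P[k ek]|[k ->]].
  by exists k; rewrite /flip -ek symdC [symd (bits x) _]symdC symdK.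
by rewrite -/(hamming _ _) hamming_flip1.
Qed.

Lemma bits_embedding n : cube_embedding (@bits n).
Proof.
split=> x y; first exact: cube_adjE.
rewrite -(inj_eq (@bits_inj n)) => /symdNeq[k kxy].
exists k, [ffun i => i \in flip (bits x) k]; split=> //.
by apply/setP=> i; rewrite inE ffunE.
Qed.

(** * Partial cubes and daisy cubes as embeddings *)

Definition in_induced (G : graph) (S : {set G}) x (xS : x \in S) : induced S :=
  exist _ x xS.

Lemma card_induced (G : graph) (S : {set G}) : #|induced S| = #|S|.
Proof. exact: card_sig. Qed.

Section Realize.
Variable T : finType.

Definition cube_point (A : {set T}) : Q #|T| := [ffun i => enum_val i \in A].

Lemma bits_cube_point A k :
  (k \in bits (cube_point A)) = (enum_val k \in A).
Proof. by rewrite inE ffunE. Qed.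

Lemma cube_point_inj : injective cube_point.
Proof.
move=> A B /ffunP e; apply/setP=> k; move: (e (enum_rank k)).
by rewrite !ffunE enum_rankK.
Qed.

Lemma cube_point_adj A B :
  adj (cube_point A) (cube_point B) <-> exists k, B = flip A k.
Proof.
rewrite cube_adjE; split=> -[k /setP e].
  exists (enum_val k); apply/setP=> l; move: (e (enum_rank l)).
  by rewrite !in_flip !bits_cube_point enum_rankK -(inj_eq enum_val_inj) enum_rankK.
exists (enum_rank k); apply/setP=> l.
by rewrite in_flip !bits_cube_point e in_flip -(inj_eq enum_val_inj) enum_rankK.
Qed.

Variables (G : graph) (f : G -> {set T}).
Hypothesis emb : cube_embedding f.

Definition cube_image : {set Q #|T|} :=
  (fun x => cube_point (f x)) @: [set: G].

(** The hypercubes of [partial_cube] and [daisy_cube] have coordinates in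
    ['I_n]; an embedding over any finite type of bits is carried there by an
    enumeration of the bits. *)
Lemma iso_cube_image : iso G (induced cube_image).
Proof.
have mem x : cube_point (f x) \in cube_image by exact: imset_f (in_setT x).
have inj : injective (fun x => cube_point (f x)).
  by move=> x y /cube_point_inj/(embedding_inj emb).
exists (fun x => in_induced (mem x)); split.
  apply: inj_card_bij => [x y [] /inj//|].
  by rewrite card_induced (card_imset _ inj) cardsT.
move=> x y; apply/idP/idP; last by move/(proj1 emb)/cube_point_adj.
by rewrite /adj /= /induced_adj => /cube_point_adj/(proj1 emb).
Qed.

Lemma embedding_partial_cube : 0 < #|G| -> partial_cube G.
Proof.
move=> G0; split; first by split=> //; exact: embedding_connect emb.
exists #|T|, cube_image; split; last exact: iso_cube_image.
move=> x y; pose h (x : induced cube_image) := bits (val x).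
suff hemb : cube_embedding h.
  by rewrite (embedding_dist hemb) (embedding_dist (bits_embedding _)).
split=> {}x {}y; first exact: cube_adjE.
case: x y => [_ /[dup]/imsetP[u _ ->] uS] [_ /[dup]/imsetP[v _ ->] vS].
rewrite -(inj_eq val_inj) /= => nuv.
have /(proj2 emb)[k [w [kuv e]]] : u != v by apply: contraNneq nuv => ->.
have wS : cube_point (f w) \in cube_image by exact: imset_f (in_setT w).
exists (enum_rank k), (in_induced wS); split.
  by rewrite in_symd !bits_cube_point enum_rankK -in_symd.
apply/setP=> l; rewrite in_flip !bits_cube_point e in_flip.
by rewrite -(inj_eq enum_val_inj) enum_rankK.
Qed.

End Realize.

(** The first edge of a shortest walk towards [y] must flip a bit on which the
    two ends differ, since the rest of the walk is too short otherwise. *)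
Lemma partial_cube_embedding G :
  partial_cube G -> exists n (f : G -> {set 'I_n}), cube_embedding f.
Proof.
case=> cG [n [S [isoS iGS]]].
have [_ cS] := iso_connected iGS cG.
suff hemb : cube_embedding (fun x : induced S => bits (val x)).
  case: iGS => g [bg gadj]; exists n, ((fun x : induced S => bits (val x)) \o g).
  exact: embedding_iso hemb bg gadj.
have distE (x y : induced S) : dist x y = hamming (bits (val x)) (bits (val y)).
  by rewrite isoS (embedding_dist (bits_embedding _)).
split=> x y; first exact: cube_adjE.
move=> nxy; have /walkP[[|z p] [sp]] := walk_dist (cS x y).
  by move=> _ /= exy; rewrite exy eqxx in nxy.
case/andP=> /cube_adjE[k ek] pp lp; exists k, z; split=> //.
have pz : dist z y <= size p.
  rewrite /dist leqNgt; apply/negP=> lt.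
  have ltn : size p < #|induced S|.
    by apply: leq_trans lt _; rewrite -[X in _ <= X](size_iota 0) find_size.
  move/(before_find 0): lt; rewrite nth_iota // add0n => /negbT/negP[].
  by apply/walkP; exists p.
move: pz sp; rewrite !distE ek.
move: (bits (val x)) (bits (val y)) => A B pz.
rewrite -[size (z :: p)]/(size p).+1 => sp.
by have := hamming_flip A B k; case: (k \in _) => //=; lia.
Qed.

(** Down-sets are isometric: to go from [x] to [y] first remove the bits of [x]
    that [y] lacks, then add bits of [y] while staying below [y]. *)
Lemma daisy_embedding G :
  daisy_cube G -> exists n (f : G -> {set 'I_n}),
    [/\ cube_embedding f, 0 < #|G| &
        forall x k, k \in f x -> exists y, f y = flip (f x) k].
Proof.
case=> n [D [/set0Pn[x0 x0D] downD [g [bg gadj]]]].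
have down (x : induced D) (A : {set 'I_n}) :
    A \subset bits (val x) -> exists y : induced D, bits (val y) = A.
  move/subsetP=> sA; have yD : [ffun i => i \in A] \in D.
    apply: (downD _ _ (valP x)) => i; rewrite ffunE.
    by case: (boolP (i \in A)) => // /sA; rewrite inE => ->.
  by exists (in_induced yD); apply/setP=> i; rewrite inE ffunE.
have hemb : cube_embedding (fun x : induced D => bits (val x)).
  split=> x y; first exact: cube_adjE.
  rewrite -(inj_eq val_inj) -(inj_eq (@bits_inj n)) => nxy.
  have [sxy|/subsetPn[k kx ky]] := boolP (bits (val x) \subset bits (val y)).
    have [k kxy] := symdNeq nxy; exists k.
    have [|z ez] := down y (flip (bits (val x)) k); last by exists z.
    apply/subsetP=> l; rewrite in_flip; case: eqP => [->|_].
      by move: kxy; rewrite in_symd; case: (k \in bits (val x)).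
    by rewrite addbF => /(subsetP sxy).
  exists k; have [|z ez] := down x (flip (bits (val x)) k).
    by rewrite flip_rem // subsetDl.
  by exists z; rewrite in_symd kx (negPf ky).
exists n, ((fun x : induced D => bits (val x)) \o g).
split; first exact: embedding_iso hemb bg gadj.
  by rewrite (bij_eq_card bg); apply/card_gt0P; exists (in_induced x0D).
move=> x k kx; have [|z /= ez] := down (g x) (flip (bits (val (g x))) k).
  by rewrite flip_rem // subsetDl.
by case: bg => g' _ gK; exists (g' z); rewrite /= gK.
Qed.

(** A graph is daisy as soon as its image is closed under moving towards some
    fixed set [Z], for translating by [Z] turns the image into a down-set. *)
Lemma embedding_daisy (G : graph) (T : finType) (f : G -> {set T}) Z :
  cube_embedding f -> 0 < #|G| ->
  (forall x k, k \in symd (f x) Z -> exists y, f y = flip (f x) k) ->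
  daisy_cube G.
Proof.
move=> emb /card_gt0P[x0 _] step; pose g x := symd (f x) Z.
have gemb : cube_embedding g by exact: translate_embedding.
have down x (A : {set T}) : A \subset g x -> exists y, g y = A.
  move: {2}#|_| (erefl #|g x :\: A|) => n.
  elim: n x => [|n IHn] x e sA.
    exists x; apply/eqP; rewrite eqEsubset sA andbT -setD_eq0.
    by rewrite -cards_eq0 e.
  have /card_gt0P[k] : 0 < #|g x :\: A| by rewrite e.
  rewrite inE => /andP[kA kx]; have [y ey] := step x k kx.
  have egy : g y = g x :\ k by rewrite -flip_rem // /g ey symd_flip.
  apply: (IHn y); last by rewrite egy subsetD1 sA.
  by move: e; rewrite (cardsD1 k) inE kA kx egy add1n => -[<-];
     rewrite !setDDl setUC.
exists #|T|, (cube_image g); split; last exact: iso_cube_image.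
  by apply/set0Pn; exists (cube_point (g x0)); exact: imset_f (in_setT x0).
move=> _ y /imsetP[x _ ->] le_yx.
have [|z ez] := down x [set k | y (enum_rank k)].
  apply/subsetP=> k; rewrite inE => yk.
  by have := le_yx (enum_rank k); rewrite ffunE enum_rankK yk lt0b.
suff -> : y = cube_point (g z) by exact: imset_f (in_setT z).
by apply/ffunP=> i; rewrite ffunE ez inE enum_valK.
Qed.

(** * Intrinsic obstruction and minors in coordinates *)

Lemma downward_bottom (G : graph) (T : finType) (g : G -> {set T}) :
  0 < #|G| -> (forall x k, k \in g x -> exists y, g y = flip (g x) k) ->
  exists z, g z = set0.
Proof.
case/card_gt0P=> x0 _ down.
case: (arg_minnP (fun x => #|g x|) (erefl : predT x0)) => z _ minz.
exists z; apply/eqP; rewrite -subset0; apply/subsetP=> k kz.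
have [y ey] := down z k kz.
by have := minz y isT; have := card_flip (g z) k; rewrite ey kz /=; lia.
Qed.

(** Every cube embedding of a daisy cube sees the down-set structure, not only
    the embedding the daisy cube comes with.  Let [z] be the bottom vertex.  In
    the daisy coordinates a vertex [x] at distance [d] from [z] has [d]
    neighbours closer to [z], one for each of its bits.  In the coordinates [f]
    the closer neighbours of [x] are among the [d] flips of the bits on which
    [x] and [z] differ.  Hence all these flips are vertices. *)
Lemma daisy_base (G : graph) (T : finType) (f : G -> {set T}) :
  cube_embedding f -> daisy_cube G ->
  exists z, forall x k, k \in symd (f x) (f z) -> exists y, f y = flip (f x) k.
Proof.
move=> femb /daisy_embedding[n [g [gemb G0 down]]].
have [z gz0] := downward_bottom G0 down.
exists z => x; pose N := [set y | adj x y && (dist y z < dist x z)].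
have dg y : dist y z = #|g y|.
  rewrite (embedding_dist gemb) gz0 /hamming; apply: eq_card => k.
  by rewrite in_symd inE addbF.
have leg : #|g x| <= #|N|.
  rewrite -(card_imset _ set1_inj).
  apply: leq_trans (leq_imset_card (fun y => symd (g y) (g x)) _).
  apply/subset_leq_card/subsetP=> _ /imsetP[k kx ->].
  have [y ey] := down x k kx; apply/imsetP; exists y; last first.
    by rewrite ey symd_flipl.
  rewrite inE (embedding_adj gemb ey) !dg.
  by have := card_flip (g x) k; rewrite ey kx /=; lia.
have sfN : (fun y => symd (f y) (f x)) @: N \subset set1 @: symd (f x) (f z).
  apply/subsetP=> _ /imsetP[y + ->]; rewrite inE => /andP[/(proj1 femb)[k ek] lt].
  rewrite ek symd_flipl imset_f //; move: lt; rewrite !(embedding_dist femb) ek.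
  by have := hamming_flip (f x) (f z) k; case: (k \in _) => //=; lia.
have injf : injective (fun y => symd (f y) (f x)).
  by move=> y y' /symd_injl/(embedding_inj femb).
have/eqP eN : (fun y => symd (f y) (f x)) @: N == set1 @: symd (f x) (f z).
  rewrite eqEcard sfN (card_imset _ injf) (card_imset _ set1_inj).
  by rewrite -/(hamming _ _) -(embedding_dist femb) dg.
move=> k /(imset_f set1); rewrite -eN => /imsetP[y _ /esym/symd_eq1 ey].
by exists y.
Qed.

(** The common reason why graphs below fail to be daisy.  Whatever the base [z]
    is, on bit [j] it agrees with exactly one of [A] and [B], say [A]; then the
    vertex [flip A j] differs from [z] on [j], and moving it towards [z] should
    give a vertex, but gives the missing set [A]. *)
Lemma not_daisy (G : graph) (T : finType) (f : G -> {set T}) A B j :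
  cube_embedding f -> j \in symd A B ->
  (forall x, f x <> A) -> (forall x, f x <> B) ->
  (exists x, f x = flip A j) -> (exists x, f x = flip B j) -> ~ daisy_cube G.
Proof.
move=> emb jAB nA nB [x ex] [y ey] /(daisy_base emb)[z hz].
have [jz|jz] := boolP (j \in symd A (f z)).
  have [|w ew] := hz y j; last by apply: (nB w); rewrite ew ey flipK.
  move: jAB jz; rewrite ey !in_symd inE eqxx.
  by case: (j \in A) (j \in B) (j \in f z) => [] [] [].
have [|w ew] := hz x j; last by apply: (nA w); rewrite ew ex flipK.
by move: jz; rewrite ex !in_symd inE eqxx; case: (j \in A) (j \in f z) => [] [].
Qed.

Section Minors.
Variables (G : graph) (T : finType) (f : G -> {set T}).
Hypothesis emb : cube_embedding f.
Variables (u v : G) (k : T).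
Hypothesis euv : f v = flip (f u) k.

(** [k] is the bit of the class of [uv], so its halfspaces fix that bit. *)
Lemma in_halfspace z : (z \in halfspace u v) = ((k \in f z) == (k \in f u)).
Proof.
rewrite inE !(embedding_dist emb) euv.
have := hamming_flip (f u) (f z) k; rewrite in_symd.
by case: (k \in f u) (k \in f z) => [] [] /=; lia.
Qed.

Lemma restriction_embedding :
  cube_embedding (fun z : restriction u v => f (val z)).
Proof.
split=> x y; first exact: (proj1 emb).
move=> nxy; have [l [x' [lxy ex']]] := proj2 emb (val x) (val y) nxy.
suff x'P : x' \in halfspace u v by exists l, (in_induced x'P).
have nkl : k != l.
  apply: contraTneq lxy => <-; rewrite in_symd.
  have := valP x; have := valP y; rewrite /= !in_halfspace.
  by move=> /eqP-> /eqP->; rewrite addbb.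
by rewrite in_halfspace ex' in_flip (negPf nkl) addbF -in_halfspace (valP x).
Qed.

Lemma restriction_image A :
  (exists z : restriction u v, f (val z) = A) <->
  (exists2 x, f x = A & (k \in A) = (k \in f u)).
Proof.
split=> [[z <-]|[x ex kA]].
  by exists (val z) => //; have := valP z; rewrite /= in_halfspace => /eqP.
have xP : x \in halfspace u v by rewrite in_halfspace ex kA.
by exists (in_induced xP).
Qed.

(** In coordinates, two edges are in relation Theta if and only if they flip the
    same bit. *)
Lemma Theta_edgeE x y : Theta_edge u v x y <-> f y = flip (f x) k.
Proof.
have th l : f y = flip (f x) l -> Theta x y u v = (l == k).
  move=> ey; rewrite /Theta !(embedding_dist emb) euv ey.
  move: (f x) (f u) => A B.
  have h1 := hamming_flip A B l.
  have h2 := hamming_flip B A k; rewrite (hammingC _ A) (hammingC _ A) (symdC B) in h2.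
  have := hamming_flip A (flip B k) l.
  rewrite in_symd in_flip addbA -in_symd; move: h1 h2.
  case: eqP => [->|_]; first by case: (k \in _) => /=; lia.
  by case: (k \in _) (l \in _) => [] [] /=; lia.
split=> [/andP[/(proj1 emb)[l el]]|e]; first by rewrite (th l el) => /eqP <-.
by rewrite /Theta_edge (embedding_adj emb e) (th k e) eqxx.
Qed.

Lemma flipD1 (A : {set T}) l :
  flip A l :\ k = if l == k then A :\ k else flip (A :\ k) l.
Proof.
apply/setP=> m; case: (eqVneq l k) => [->|nlk]; rewrite !(in_flip, inE).
  by case: (m == k); rewrite ?addbF.
by case: (eqVneq m k) => [->|//]; rewrite eq_sym (negPf nlk).
Qed.

(** Contracting the class of bit [k] forgets that bit: two vertices with the
    same remaining bits are equal or are joined by an edge of the class. *)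
Lemma Theta_connectE x y :
  connect (Theta_edge u v) x y = (f x :\ k == f y :\ k).
Proof.
apply/idP/eqP=> [/connectP[p pp ->]|e].
  elim: p x pp => //= z p IHp x /andP[/Theta_edgeE exz /IHp <-].
  by rewrite exz flipD1 eqxx.
have [kxy|kxy] := boolP (k \in symd (f x) (f y)).
  apply/connect1/Theta_edgeE/setP=> l; rewrite in_flip.
  case: (eqVneq l k) => [->|nlk].
    by move: kxy; rewrite in_symd; case: (k \in f x) (k \in f y) => [] [].
  by move/setP/(_ l): e; rewrite !inE nlk addbF.
suff -> : x = y by [].
apply: (embedding_inj emb); apply/setP=> l.
case: (eqVneq l k) => [->|nlk]; last by move/setP/(_ l): e; rewrite !inE nlk.
by move: kxy; rewrite in_symd; case: (k \in f x) (k \in f y) => [] [].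
Qed.

(** All representatives give the same set, by [Theta_connectE]; [u] is the default
    of a pick that succeeds, since classes are nonempty. *)
Definition contraction_code (C : contraction u v) : {set T} :=
  f (odflt u [pick x in val C]) :\ k.

Lemma in_class (C : contraction u v) x :
  (x \in val C) = (f x :\ k == contraction_code C).
Proof.
have /imsetP[x0 _ eC] : val C \in equivalence_partition (connect (Theta_edge u v)) setT.
  exact: valP C.
have inC y : (y \in val C) = (f x0 :\ k == f y :\ k).
  by rewrite eC !inE Theta_connectE.
rewrite /contraction_code; case: pickP => [w|/(_ x0)]; rewrite inC.
  by move/eqP=> <-; rewrite inC eq_sym.
by rewrite eqxx.
Qed.

Lemma contraction_image A :
  (exists C, contraction_code C = A) <-> (exists x, f x :\ k = A).
Proof.
split=> [[C <-]|[x <-]]; first by exists (odflt u [pick x in val C]).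
pose X := [set y in [set: G] | connect (Theta_edge u v) x y].
have XP : X \in equivalence_partition (connect (Theta_edge u v)) setT.
  by apply/imsetP; exists x.
exists (exist _ X XP : contraction u v); apply/esym/eqP.
by rewrite -in_class !inE connect0.
Qed.

Lemma contraction_code_inj : injective contraction_code.
Proof. by move=> C D e; apply/val_inj/setP=> x; rewrite !in_class e. Qed.

(** A greedy step that only flips the contracted bit stays in the class; at
    most one such step is made, after which a step between distinct classes
    must follow. *)
Lemma contraction_step (C D : contraction u v) : C != D ->
  exists x x' l, [/\ x \in val C, f x' = flip (f x) l, l != k &
                    l \in symd (contraction_code C) (contraction_code D)].
Proof.
rewrite -(inj_eq contraction_code_inj).
set x := odflt u [pick x in val C]; set y := odflt u [pick x in val D].
have eC : contraction_code C = f x :\ k by [].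
have eD : contraction_code D = f y :\ k by [].
have diff l : l != k -> (l \in symd (f x :\ k) (f y :\ k)) = (l \in symd (f x) (f y)).
  by move=> nlk; rewrite !in_symd !inE nlk.
rewrite eC eD => nCD; have nxy : x != y by apply: contraNneq nCD => ->.
have [l [x' [lxy ex']]] := proj2 emb x y nxy.
have [elk|nlk] := eqVneq l k; last first.
  by exists x, x', l; rewrite in_class eC eqxx diff.
have ex'k : f x' :\ k = f x :\ k by rewrite ex' flipD1 elk eqxx.
have nx'y : x' != y by apply: contraNneq nCD => <-; rewrite ex'k.
have [m [x'' [mxy ex'']]] := proj2 emb x' y nx'y.
have nmk : m != k.
  apply: contraTneq mxy => ->; move: lxy; rewrite elk ex' elk !in_symd inE eqxx.
  by case: (k \in f x) (k \in f y) => [] [].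
exists x', x'', m; rewrite in_class eC ex'k eqxx; split=> //.
by rewrite -ex'k !in_symd !inE nmk -in_symd.
Qed.

Lemma contraction_embedding : cube_embedding contraction_code.
Proof.
split=> C D; last first.
  move=> /contraction_step[x [x' [l [xC ex' nlk lCD]]]]; exists l.
  have [_ /(_ (ex_intro _ x' erefl))[E eE]] := contraction_image (f x' :\ k).
  exists E; split=> //; rewrite eE ex' flipD1 (negPf nlk).
  by move: xC; rewrite in_class => /eqP->.
split=> [/andP[nCD /exists_inP[x xC /exists_inP[y yD /(proj1 emb)[l el]]]]|[l el]].
  move: xC yD; rewrite !in_class => /eqP eC /eqP eD; exists l.
  rewrite -eC -eD el flipD1; case: eqP => // elk; case/eqP: nCD.
  by apply: contraction_code_inj; rewrite -eC -eD el flipD1 elk eqxx.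
have nCD : C != D.
  by rewrite -(inj_eq contraction_code_inj) el eq_sym flip_neq.
have [x [x' [m [xC ex' nmk]]]] := contraction_step nCD.
rewrite el symdC symd_flipl inE => /eqP eml.
apply/andP; split=> //; apply/exists_inP; exists x => //.
apply/exists_inP; exists x'; last exact: (embedding_adj emb ex').
rewrite in_class ex' flipD1 (negPf nmk) el eml.
by move: xC; rewrite in_class => /eqP->.
Qed.

Lemma restriction_small : #|restriction u v| < #|G|.
Proof.
rewrite card_induced -cardsT; apply: proper_card; rewrite properT.
apply/eqP=> /setP/(_ v); rewrite in_halfspace euv in_flip eqxx inE.
by case: (k \in f u).
Qed.

Lemma contraction_small : #|contraction u v| < #|G|.
Proof.
pose rep (C : contraction u v) := odflt u [pick x in val C].
have rep_inj : injective rep.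
  move=> C D e; apply: contraction_code_inj.
  by rewrite /contraction_code -/(rep C) -/(rep D) e.
rewrite -cardsT -(card_imset _ rep_inj) -[X in _ < X]cardsT.
apply: proper_card; rewrite properT; apply/eqP=> /setP img.
have /imsetP[C _ eu] : u \in rep @: [set: contraction u v] by rewrite img inE.
have /imsetP[D _ ev] : v \in rep @: [set: contraction u v] by rewrite img inE.
have eCD : C = D.
  apply: contraction_code_inj; rewrite /contraction_code -/(rep C) -/(rep D).
  by rewrite -eu -ev euv flipD1 eqxx.
by have /eqP := flip_neq (f u) k; rewrite -euv ev -eCD -eu.
Qed.

End Minors.

Lemma restriction_daisy (G : graph) (u v : G) :
  adj u v -> daisy_cube G -> daisy_cube (restriction u v).
Proof.
move=> auv /daisy_embedding[n [g [gemb _ down]]].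
have [k euv] := proj1 (proj1 gemb u v) auv.
have inH := in_halfspace gemb euv.
apply: (@embedding_daisy _ _ _ (if k \in g u then [set k] else set0)
          (restriction_embedding gemb euv)).
  have uH : u \in halfspace u v by rewrite inH.
  by apply/card_gt0P; exists (in_induced uH).
move=> x l lx; apply/(restriction_image gemb euv).
have kx : (k \in g (val x)) = (k \in g u) by apply/eqP; rewrite -inH (valP x).
have [nlk lgx] : l != k /\ l \in g (val x).
  move: lx; rewrite in_symd; case: eqVneq => [->|nlk].
    by rewrite kx; case: (k \in g u); rewrite inE ?eqxx.
  by case: ifP; rewrite inE ?(negPf nlk) addbF.
have [y ey] := down _ _ lgx.
by exists y; rewrite // in_flip eq_sym (negPf nlk) addbF.
Qed.

Lemma contraction_daisy (G : graph) (u v : G) :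
  adj u v -> daisy_cube G -> daisy_cube (contraction u v).
Proof.
move=> auv /daisy_embedding[n [g [gemb _ down]]].
have [k euv] := proj1 (proj1 gemb u v) auv.
have img := contraction_image gemb euv.
apply: (@embedding_daisy _ _ _ set0 (contraction_embedding gemb euv)).
  by have [C _] := proj2 (img _) (ex_intro _ u erefl); apply/card_gt0P; exists C.
move=> C l lC; apply/img; have [x ex] := proj1 (img _) (ex_intro _ C erefl).
move: lC; rewrite in_symd -ex !inE addbF => /andP[nlk lx].
have [y ey] := down _ _ lx.
by exists y; rewrite ey flipD1 (negPf nlk).
Qed.

(** * The grid as a family of sets of bits *)

Section Code.
Variables r s : nat.
Local Notation bit := ('I_r * bool + 'I_s)%type.
Local Notation side i b := (inl (i, b) : bit).
Implicit Types (X Y A B : {set bit}) (x y : Defs.B r s) (t : {ffun 'I_s -> bool}).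

(** The bits of the grid embedding: [inl (i, true)] and [inl (i, false)] say
    that the ternary coordinate [i] is 2, respectively 0, so that the middle
    value 1 is the empty one; [inr j] says that the binary coordinate [j] agrees
    with the reference vector [t].  Grid sets are the sets of bits that occur. *)
Definition grid_set X := forall i, ~~ ((side i true \in X) && (side i false \in X)).

Definition corner_set X := forall i, (side i true \in X) = (side i false \notin X).

Definition grid_code t x : {set bit} :=
  [set k : bit | match k with
                 | inl (i, b) => x.1 i == 2 * b :> nat
                 | inr j => x.2 j == t j
                 end].

Lemma in_code_side t x i b : (side i b \in grid_code t x) = (x.1 i == 2 * b :> nat).
Proof. by rewrite inE. Qed.

Lemma in_code_inr t x j : (inr j \in grid_code t x) = (x.2 j == t j).
Proof. by rewrite inE. Qed.

Lemma grid_code_set t x : grid_set (grid_code t x).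
Proof. by move=> i; rewrite !in_code_side; case: eqP => // ->. Qed.

Lemma coord_code t x i :
  x.1 i = (if side i true \in grid_code t x then 2
           else if side i false \in grid_code t x then 0 else 1) :> nat.
Proof. by rewrite !in_code_side; case: (x.1 i) => [[|[|[|]]]]. Qed.

Lemma grid_code_inj t : injective (grid_code t).
Proof.
move=> x y e; rewrite (surjective_pairing x) (surjective_pairing y); congr pair.
  by apply/ffunP=> i; apply: val_inj; rewrite /= !(coord_code t) e.
apply/ffunP=> j; move/setP/(_ (inr j)): e; rewrite !in_code_inr.
by case: (x.2 j) (y.2 j) (t j) => [] [] [].
Qed.

Lemma grid_code_surj t X : grid_set X -> exists x, grid_code t x = X.
Proof.
move=> gX; exists ([ffun i => if side i true \in X then inord 2 else
                   if side i false \in X then inord 0 else inord 1],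
         [ffun j => (inr j \in X) == t j]).
apply/setP=> -[[i b]|j]; last first.
  by rewrite in_code_inr ffunE; case: (inr j \in X) (t j) => [] [].
rewrite in_code_side ffunE; have := gX i.
by case: b; case: (_ \in X); case: (_ \in X) => //=; rewrite !inordK.
Qed.

(** Moving by one on a path with three vertices enters or leaves an end, which
    changes exactly one of its two bits. *)
Lemma grid_code_adj t x y :
  adj x y <-> exists k, grid_code t y = flip (grid_code t x) k.
Proof.
split.
  case/existsP=> -[i|j] /andP[/forallP same step].
    exists (side i (x.1 i + y.1 i == 3)); apply/setP=> -[[i' b]|j'].
      have := same (inl i'); rewrite in_flip !in_code_side !(inj_eq inl_inj).
      rewrite xpair_eqE; case: (i' =P i) => [->|_] /=.
        move: step; rewrite /coord.
        by case: (x.1 i) (y.1 i) b => [[|[|[|]]]] //= ? [[|[|[|]]]] //= ? [].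
      by rewrite addbF => /eqP/negbFE/eqP->.
    have := same (inr j'); rewrite in_flip !in_code_inr /= addbF.
    by case: (x.2 j') (y.2 j') (t j') => [] [] [].
  exists (inr j); apply/setP=> -[[i' b]|j'].
    have := same (inl i'); rewrite in_flip !in_code_side /= addbF.
    by move=> /eqP/negbFE/eqP->.
  have := same (inr j'); rewrite in_flip !in_code_inr !(inj_eq inr_inj) /=.
  by case: (_ == j); case: (x.2 j') (y.2 j') (t j') => [] [] [].
case=> k e; have gx := grid_code_set t x; have gy := grid_code_set t y.
have inrE j : (x.2 j == y.2 j) = (inr j != k).
  have := in_code_inr t y j; rewrite e in_flip in_code_inr.
  by case: (inr j == k); case: (x.2 j) (y.2 j) (t j) => [] [] [].
have inlE i : x.1 i != y.1 i :> nat -> exists b, k = side i b.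
  rewrite !(coord_code t) e !in_flip.
  have [<-|_] := eqVneq (side i true) k; first by exists true.
  have [<-|_] := eqVneq (side i false) k; first by exists false.
  by rewrite !addbF eqxx.
case: k e inrE inlE => [[i b]|j] e inrE inlE; apply/existsP.
  exists (inl i).
  have step : (x.1 i == (y.1 i).+1 :> nat) || (y.1 i == (x.1 i).+1 :> nat).
    have := gy i; rewrite !(coord_code t) e !in_flip.
    rewrite !(inj_eq inl_inj) !xpair_eqE eqxx; have := gx i.
    by case: b {e inrE inlE}; case: (_ \in _); case: (_ \in _).
  rewrite step andbT; apply/forallP=> -[i'|j'] /=.
    rewrite (inj_eq inl_inj); apply/eqP; apply/idP/eqP=> [/inlE[b' [->]]//|->].
    by apply/eqP=> exy; move: step; rewrite exy orbb (ltn_eqF (ltnSn _)).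
  by have := inrE j'; case: (x.2 j') (y.2 j') => [] [].
exists (inr j); apply/andP; split.
  apply/forallP=> -[i'|j'] /=.
    by apply/eqP/negbTE/negP=> /inlE[].
  rewrite (inj_eq inr_inj); have := inrE j'; rewrite (inj_eq inr_inj).
  by case: (_ == j); case: (x.2 j') (y.2 j') => [] [].
by have := inrE j; rewrite eqxx /=; case: (x.2 j) (y.2 j) => [] [].
Qed.

Lemma corner_code t x : corner x -> corner_set (grid_code t x).
Proof. by move=> cx i; rewrite !in_code_side; case: (cx i) => ->. Qed.

End Code.

Section SetLevel.
Variables r s : nat.
Local Notation bit := ('I_r * bool + 'I_s)%type.
Local Notation side i b := (inl (i, b) : bit).
Implicit Types (X Y A B : {set bit}).

Lemma grid_set_sub X Y : X \subset Y -> grid_set Y -> grid_set X.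
Proof.
move=> /subsetP sXY gY i; apply: contra (gY i) => /andP[/sXY-> /sXY->] //.
Qed.

Lemma side_eqE i b i' b' :
  (side i b == side i' b') = (i == i') && (b == b').
Proof. by rewrite (inj_eq inl_inj) xpair_eqE. Qed.

Lemma grid_set_flip X k :
  grid_set X -> (forall i b, k = side i b -> side i (~~ b) \notin X) ->
  grid_set (flip X k).
Proof.
move=> gX kX i; have := gX i; rewrite !in_flip.
case: k kX => [[i' b]|j] kX; last by rewrite !addbF.
rewrite !side_eqE; have [ei|_] := eqVneq i i'; last by rewrite !addbF.
rewrite ei; by have /negPf := kX i' b erefl; case: b {kX} => ->; rewrite ?andbF.
Qed.

Lemma corner_set_grid A : corner_set A -> grid_set A.
Proof. by move=> cA i; rewrite cA andNb. Qed.

Lemma corner_side A i : corner_set A -> exists b, side i b \in A.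
Proof.
move=> /(_ i); case: (boolP (side i true \in A)) => [|_]; first by exists true.
by move=> /esym/negbFE; exists false.
Qed.

Lemma corner_other A i b : corner_set A -> (side i (~~ b) \in A) = (side i b \notin A).
Proof. by move=> /(_ i) cA; case: b; rewrite cA ?negbK. Qed.

(** Deleting two corners leaves room to move greedily from [X] to [Y], unless
    the two corners differ in exactly two binary coordinates.  If [X] has an end
    bit that [Y] lacks, removing it gives a set that is not a corner.  Otherwise
    all the flips towards [Y] stay in the grid.  If [Y] has an end bit at a
    coordinate where [X] is in the middle, then any flip elsewhere leaves that
    coordinate in the middle, again not a corner, and if there is no other flip
    then this one reaches [Y].  There remain flips of binary
    bits; if there are two of them, both leading to deleted corners, then these
    corners differ in just those two bits. *)
Lemma grid_step A B X Y :
  corner_set A -> corner_set B -> grid_set X -> grid_set Y ->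
  X <> Y -> Y <> A -> Y <> B ->
  (exists k, [/\ k \in symd X Y, grid_set (flip X k), flip X k <> A & flip X k <> B])
  \/ exists j j', j != j' /\ symd A B = [set inr j; inr j'].
Proof.
move=> cA cB gX gY /eqP nXY nYA nYB.
have notcorner i X' : side i true \notin X' -> side i false \notin X' ->
    X' <> A /\ X' <> B.
  by move=> nt nf; split=> e; move: nt nf; rewrite e ?cA ?cB => /negPf->.
have excl b i Z : grid_set Z -> side i b \in Z -> side i (~~ b) \notin Z.
  by move=> /(_ i); case: b; case: (_ \in Z); case: (_ \in Z).
have [/existsP[[i b] /andP[iX iY]]|/existsPn sub] :=
  boolP [exists ib : 'I_r * bool, (inl ib \in X) && (inl ib \notin Y)].
  left; exists (side i b).
  have iX' := excl _ _ _ gX iX.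
  have [||? ?] := notcorner i (flip X (side i b)).
  - by rewrite in_flip side_eqE eqxx; case: b iX iX' {iY} => [-> // | _ /negPf->].
  - by rewrite in_flip side_eqE eqxx; case: b iX iX' {iY} => [_ /negPf-> // | ->].
  split=> //; first by rewrite in_symd iX (negPf iY).
  by apply: grid_set_sub gX; rewrite flip_rem // subsetDl.
have subXY ib : inl ib \in X -> inl ib \in Y.
  by move=> iX; apply: contraNT (sub ib) => iY; rewrite iX iY.
have good k : k \in symd X Y -> grid_set (flip X k).
  move=> kXY; apply: grid_set_flip => // i b ek; apply/negP=> /subXY iY.
  have := excl _ _ _ gY iY; rewrite negbK; move: kXY; rewrite ek in_symd.
  by case: (boolP (side i b \in X)) => [/subXY|_] /= ->.
have [k kXY] := symdNeq nXY.
have only k' : symd X Y = [set k'] -> flip X k' = Y.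
  by move=> e; rewrite /flip -e symdC [symd X Y]symdC symdK.
have [/eqP ke|nke] := boolP (symd X Y == [set k]).
  by left; exists k; rewrite (only _ ke); split.
have another k' : k' \in symd X Y -> exists2 l, l \in symd X Y & l != k'.
  move=> k'XY; have [/eqP k'e|] := boolP (symd X Y == [set k']).
    exists k => //; move: nke; rewrite k'e => /eqP nk.
    by apply/eqP=> e; apply: nk; rewrite e.
  rewrite eqEsubset sub1set k'XY andbT => /subsetPn[l lXY].
  by rewrite inE => nl; exists l.
have [/existsP[[i b] ibXY]|/existsPn noside] :=
  boolP [exists ib : 'I_r * bool, inl ib \in symd X Y].
  have [l lXY nl] := another _ ibXY; left; exists l.
  have [iY iX] : side i b \in Y /\ side i b \notin X.
    move: ibXY; rewrite in_symd; case: (boolP (side i b \in X)) => [/subXY->|] //.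
  have iY' := excl _ _ _ gY iY.
  have iX' : side i (~~ b) \notin X by apply: contra iY' => /subXY.
  have nl' : l != side i (~~ b).
    by apply: contraTneq lXY => ->; rewrite in_symd (negPf iX') (negPf iY').
  have nin b' : side i b' \notin flip X l.
    rewrite in_flip; have [->|nb] := eqVneq b' b.
      by rewrite (negPf iX) eq_sym (negPf nl).
    have -> : b' = ~~ b by move: nb; case: (b) (b') => [] [].
    by rewrite (negPf iX') eq_sym (negPf nl').
  have [? ?] := notcorner i _ (nin true) (nin false).
  by split=> //; exact: good.
have isinr l : l \in symd X Y -> exists j, l = inr j.
  by case: l => [ib|j]; [rewrite (negPf (noside ib)) | exists j].
have [l lXY nlk] := another _ kXY.
have ok m : m \in symd X Y ->
    (exists k, [/\ k \in symd X Y, grid_set (flip X k), flip X k <> A & flip X k <> B])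
    \/ flip X m \in [set A; B].
  move=> mXY; rewrite !inE; case: eqP => [|nA]; first by right.
  by case: eqP => [|nB]; [right | left; exists m; split; auto].
have [|kAB] := ok _ kXY; first by left.
have [|lAB] := ok _ lXY; first by left.
right; have [j ej] := isinr _ kXY; have [j' ej'] := isinr _ lXY.
have njj : j' != j by apply: contraNneq nlk => e; rewrite ej ej' e.
exists j, j'; split; first by rewrite eq_sym.
have e2 : symd (flip X k) (flip X l) = [set k; l].
  apply/setP=> m; rewrite in_symd !in_flip !inE.
  have [->|_] := eqVneq m k; last by rewrite addbF; case: (m \in X) (m == l) => [] [].
  by rewrite eq_sym (negPf nlk); case: (_ \in X).
have nfl : flip X k != flip X l by rewrite (inj_eq (@flip_inj _ X)) eq_sym.
rewrite -ej -ej' -e2; move: kAB lAB nfl; rewrite !inE.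
by do 2!case/orP=> /eqP ->; rewrite ?eqxx // symdC.
Qed.
End SetLevel.

(** * The grid with two corners removed *)

Section Corners.
Variables (r s : nat) (a b : Defs.B r s).
Hypotheses (corner_a : corner a) (corner_b : corner b).
Local Notation bit := ('I_r * bool + 'I_s)%type.
Local Notation side i c := (inl (i, c) : bit).
Local Notation H := (B_minus a b).
Local Notation p := (p_corners a b).
Local Notation q := (q_corners a b).

(** The binary coordinates are measured against those of [a], so that [code_a]
    contains all binary bits and is maximal among grid sets. *)
Definition code (x : H) : {set bit} := grid_code a.2 (val x).
Definition code_a : {set bit} := grid_code a.2 a.
Definition code_b : {set bit} := grid_code a.2 b.

Lemma corner_code_a : corner_set code_a. Proof. exact: corner_code. Qed.
Lemma corner_code_b : corner_set code_b. Proof. exact: corner_code. Qed.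

Lemma inr_code_a j : inr j \in code_a.
Proof. by rewrite in_code_inr eqxx. Qed.

Lemma code_image X :
  (exists x, code x = X) <-> [/\ grid_set X, X <> code_a & X <> code_b].
Proof.
split=> [[x <-]|[gX nA nB]].
  have := valP x; rewrite !inE negb_or => /andP[nxa nxb].
  split; first exact: grid_code_set.
    by move/grid_code_inj/eqP; apply/negP.
  by move/grid_code_inj/eqP; apply/negP.
have [x ex] := grid_code_surj a.2 gX.
have xH : x \in ~: [set a; b].
  by rewrite !inE negb_or; apply/andP; split; apply/eqP=> e;
     [apply: nA | apply: nB]; rewrite -ex e.
by exists (in_induced xH).
Qed.

Lemma code_adj (x y : H) : adj x y <-> exists k, code y = flip (code x) k.
Proof. exact: grid_code_adj. Qed.

Lemma code_inj : injective code.
Proof. by move=> x y /grid_code_inj/val_inj. Qed.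

Lemma symd_code_inr j : (inr j \in symd code_a code_b) = (a.2 j != b.2 j).
Proof. by rewrite in_symd !in_code_inr eqxx eq_sym; case: (_ == _). Qed.

Lemma symd_code_side i c :
  (side i c \in symd code_a code_b) = ([set a.1 i; b.1 i] == [set ord0; ord_max]).
Proof.
have ord_eq0 (m : 'I_3) : m = 0 :> nat -> m = ord0 by move=> e; apply: val_inj.
have ord_eq2 (m : 'I_3) : m = 2 :> nat -> m = ord_max by move=> e; apply: val_inj.
rewrite in_symd !in_code_side.
case: (corner_a i) (corner_b i) => ea [] eb; rewrite ea eb.
- rewrite (ord_eq0 _ ea) (ord_eq0 _ eb) addbb.
  by apply/esym/eqP=> /setP/(_ ord_max); rewrite !inE.
- by rewrite (ord_eq0 _ ea) (ord_eq2 _ eb) eqxx; case: c.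
- by rewrite (ord_eq2 _ ea) (ord_eq0 _ eb) setUC eqxx; case: c.
rewrite (ord_eq2 _ ea) (ord_eq2 _ eb) addbb.
by apply/esym/eqP=> /setP/(_ ord0); rewrite !inE.
Qed.

Lemma p_corners_eq0 : p = 0 <-> forall i c, side i c \notin symd code_a code_b.
Proof.
split=> [/eqP|noside].
  rewrite cards_eq0 => /eqP/setP p0 i c.
  by rewrite symd_code_side; have := p0 i; rewrite !inE => ->.
apply/eqP; rewrite cards_eq0 -subset0; apply/subsetP=> i.
by rewrite inE -(symd_code_side i true) (negPf (noside i true)).
Qed.

Lemma q_corners_eq0 : q = 0 <-> forall j, inr j \notin symd code_a code_b.
Proof.
split=> [/eqP|noinr].
  rewrite cards_eq0 => /eqP/setP q0 j.
  by rewrite symd_code_inr; have := q0 j; rewrite !inE => ->.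
apply/eqP; rewrite cards_eq0 -subset0; apply/subsetP=> j.
by rewrite inE -symd_code_inr (negPf (noinr j)).
Qed.

Lemma opposite_symd : opposite a b <-> symd code_a code_b = setT.
Proof.
rewrite /opposite /p_corners /q_corners; split=> [[ep eq]|eT].
  have full n (P : pred 'I_n) : #|[set i | P i]| = n -> forall i, P i.
    move=> cP i; have /eqP/setP/(_ i) : [set i | P i] == setT.
      by rewrite eqEcard subsetT cardsT card_ord cP /=.
    by rewrite !inE.
  apply/setP=> -[[i c]|j]; rewrite [RHS]inE.
    by rewrite symd_code_side; apply: full ep i.
  by rewrite symd_code_inr; apply: full eq j.
split.
  rewrite -[RHS]card_ord -cardsT; apply: eq_card => i.
  by rewrite !inE -(symd_code_side i true) eT inE.
rewrite -[RHS]card_ord -cardsT; apply: eq_card => j.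
by rewrite !inE -symd_code_inr eT inE.
Qed.

Lemma corners_differ_on_pair : (p = 0 /\ q = 2) <->
  exists j j', j != j' /\ symd code_a code_b = [set inr j; inr j'].
Proof.
split=> [[/p_corners_eq0 noside /eqP/cards2P[j [j' [njj e]]]]|[j [j' [njj e]]]].
  exists j, j'; split=> //; apply/setP=> -[[i c]|l].
    by rewrite (negPf (noside i c)) !inE.
  rewrite symd_code_inr; move/setP/(_ l): e; rewrite !inE => ->.
  by rewrite !(inj_eq inr_inj).
split; first by apply/p_corners_eq0 => i c; rewrite e !inE.
rewrite /q_corners (_ : [set _ | _] = [set j; j']) ?cards2 ?njj //.
apply/setP=> l; rewrite inE -symd_code_inr e !inE.
by rewrite !(inj_eq inr_inj).
Qed.

Lemma corners_differ_on_one : (p = 0 /\ q = 1) <-> exists j, symd code_a code_b = [set inr j].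
Proof.
split=> [[/p_corners_eq0 noside /eqP/cards1P[j e]]|[j e]].
  exists j; apply/setP=> -[[i c]|l].
    by rewrite (negPf (noside i c)) !inE.
  by rewrite symd_code_inr; move/setP/(_ l): e; rewrite !inE => ->.
split; first by apply/p_corners_eq0 => i c; rewrite e !inE.
rewrite /q_corners (_ : [set _ | _] = [set j]) ?cards1 //.
by apply/setP=> l; rewrite inE -symd_code_inr e !inE.
Qed.

(** This is the isometric half of the characterisation of partial cubes. *)
Lemma code_embedding : ~ (p = 0 /\ q = 2) -> cube_embedding code.
Proof.
move=> npq; split=> x y; first exact: code_adj.
move=> nxy; have gx := proj1 (code_image _) (ex_intro _ x erefl).
have [gy nya nyb] := proj1 (code_image _) (ex_intro _ y erefl).
have nc : code x <> code y by move/code_inj/eqP; apply/negP.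
case: gx => gx _ _.
have [[k [kxy gk nka nkb]]|e] :=
  grid_step corner_code_a corner_code_b gx gy nc nya nyb; last first.
  by case: npq; apply/corners_differ_on_pair.
have [x' ex'] : exists x', code x' = flip (code x) k by apply/code_image.
by exists k, x'.
Qed.

Lemma code_flip_image j C : inr j \in symd code_a code_b -> ~ (p = 0 /\ q = 1) ->
  C = code_a \/ C = code_b -> exists x, code x = flip C (inr j).
Proof.
move=> jab npq eC; apply/code_image.
have nab : flip code_a (inr j) <> code_b.
  by move=> e; apply/npq/corners_differ_on_one; exists j; rewrite -e symdC symd_flipl.
have neq D : flip D (inr j) <> D by apply/eqP/flip_neq.
split.
- apply: grid_set_flip => //.
  by case: eC => ->; apply: corner_set_grid; [apply: corner_code_a|apply: corner_code_b].
- by case: eC => ->; [exact: neq | move=> e; apply: nab; rewrite -e flipK].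
by case: eC => ->; [exact: nab | exact: neq].
Qed.

Lemma q_corners_neq0 : q <> 0 -> exists j, inr j \in symd code_a code_b.
Proof.
move=> q0; have /card_gt0P[j] : 0 < q by rewrite lt0n; apply/eqP.
by rewrite inE -symd_code_inr; exists j.
Qed.

Lemma code_missing x : code x <> code_a /\ code x <> code_b.
Proof. by have [] := proj1 (code_image _) (ex_intro _ x erefl). Qed.

(** [a] and [b] are missing and differ on a binary bit; flipping it at either of
    them gives vertices unless it exchanges [a] and [b]. *)
Lemma code_not_daisy : cube_embedding code ->
  q <> 0 -> ~ (p = 0 /\ q = 1) -> ~ daisy_cube H.
Proof.
move=> emb /q_corners_neq0[j jab] npq.
apply: (not_daisy emb jab); first by move=> x; case: (code_missing x).
- by move=> x; case: (code_missing x).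
- by apply: code_flip_image => //; left.
by apply: code_flip_image => //; right.
Qed.

(** A corner set has an end bit at every ternary coordinate already, so only a
    binary bit can be removed from a grid set to reach it. *)
Lemma flip_to_corner (C X : {set bit}) k :
  corner_set C -> grid_set X -> k \in X -> flip X k = C ->
  exists l, [/\ k = inr l, k \notin C & X = flip C k].
Proof.
move=> cC gX kX e; have kC : k \notin C by rewrite -e in_flip kX eqxx.
case: k kX e kC => [[i c]|l] kX e kC; last by exists l; split=> //; rewrite -e flipK.
have := corner_other i c cC; rewrite kC -e in_flip side_eqE eqxx => jC.
have := gX i; move: kX jC; case: c {e kC} => /= ->; rewrite ?addbF => ->.
  by [].
by rewrite andbT.
Qed.

(** When [a] and [b] have the same binary coordinates both are maximal, and when
    they differ in one binary bit alone, [a] is the only grid set above [b]; in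
    both cases deleting them keeps a down-set. *)
Lemma code_daisy : cube_embedding code -> 0 < #|H| ->
  q = 0 \/ (p = 0 /\ q = 1) -> daisy_cube H.
Proof.
move=> emb H0 pq; apply: (@embedding_daisy _ _ _ set0 emb H0) => x k.
rewrite in_symd [k \in set0]inE addbF => kx.
have [gx nxa nxb] := proj1 (code_image _) (ex_intro _ x erefl).
have gk : grid_set (flip (code x) k).
  by apply: grid_set_sub gx; rewrite flip_rem // subsetDl.
apply/code_image; split=> // e.
  have [l [ek nk _]] := flip_to_corner corner_code_a gx kx e.
  by rewrite ek inr_code_a in nk.
have [l [ek nk ex]] := flip_to_corner corner_code_b gx kx e.
have lab : inr l \in symd code_a code_b by rewrite in_symd inr_code_a -ek (negPf nk).
case: pq => [/q_corners_eq0/(_ l)|/corners_differ_on_one[j ej]]; first by rewrite lab.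
move: lab; rewrite ej inE => /eqP elj; apply: nxa.
by rewrite ex ek elj /flip -ej symdC symdK.
Qed.

(** One bit for each coordinate: the number of bits of [code_a] is the dimension
    that enters the exceptional case of the partial cubes. *)
Lemma card_code_a : #|code_a| = r + s.
Proof.
pose g (z : 'I_r + 'I_s) : bit := match z with
  | inl i => side i (side i true \in code_a) | inr j => inr j end.
have gI : injective g by move=> [i|j] [i'|j'] //= [->].
have -> : code_a = g @: setT.
  apply/setP=> k; apply/idP/imsetP=> [ka|[[i|j] _ ->] /=]; last exact: inr_code_a.
    case: k ka => [[i c]|j] ka; last by exists (inr j).
    exists (inl i) => //=; move: ka; rewrite (corner_code_a i); case: c => [+|->//].
    by rewrite corner_code_a => ->.
  case: (boolP (side i true \in code_a)) => // nt.
  by move: (corner_code_a i); rewrite (negPf nt) => /esym/negbFE.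
by rewrite card_imset // cardsT card_sum !card_ord.
Qed.

End Corners.

(** * Pendant vertices *)

(** In the exceptional case the deleted graph is the full subgraph of sets
    without [m], together with two vertices [[set j; m]] and [[set j'; m]] whose
    only remaining neighbours are obtained by removing [m].  It is not isometric
    in the grid, since the two pendant vertices have lost their two common
    neighbours.  It becomes a partial cube once the two pendant edges get bits of
    their own. *)
Section Pendants.
Variables (G : graph) (T : finType) (f : G -> {set T}) (j j' m : T).
Hypothesis f_inj : injective f.
Hypothesis f_adj : forall x y, adj x y <-> exists k, f y = flip (f x) k.
Hypotheses (njj' : j != j') (nmj : m != j) (nmj' : m != j').
Hypothesis f_image : forall X,
  (exists x, f x = X) <-> [\/ m \notin X, X = [set j; m] | X = [set j'; m]].

(** The bit [m] is replaced by two bits [inr true] and [inr false], one for each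
    pendant vertex; membership of [j] tells the two pendant vertices apart. *)
Definition pendant_code (x : G) : {set T + bool} :=
  [set k : T + bool | match k with
                      | inl i => (i \in f x) && (i != m)
                      | inr c => (m \in f x) && ((j \in f x) == c)
                      end].

Lemma in_pendant_inl x i : (inl i \in pendant_code x) = (i \in f x) && (i != m).
Proof. by rewrite inE. Qed.

Lemma in_pendant_inr x c : (inr c \in pendant_code x) = (m \in f x) && ((j \in f x) == c).
Proof. by rewrite inE. Qed.

Lemma pendant_vertex x :
  m \in f x -> f x = if j \in f x then [set j; m] else [set j'; m].
Proof.
move=> mx; have [nmx|->|->] := proj1 (f_image _) (ex_intro _ x erefl).
- by rewrite mx in nmx.
- by rewrite !inE eqxx.
by rewrite !inE (negPf njj') eq_sym (negPf nmj).
Qed.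

Lemma pendant_second_bit x : m \in f x -> (j' \in f x) = (j \notin f x).
Proof.
move=> mx; rewrite (pendant_vertex mx); case: ifP => _; rewrite !inE eqxx.
  by rewrite eq_sym (negPf njj') eq_sym (negPf nmj').
by rewrite (negPf njj') [j == m]eq_sym (negPf nmj).
Qed.

Lemma pendant_flip_inl x y i : i != m -> m \notin f x -> f y = flip (f x) i ->
  pendant_code y = flip (pendant_code x) (inl i).
Proof.
move=> nim /negPf mx ey; apply/setP=> -[l|c]; rewrite in_flip.
  rewrite !in_pendant_inl ey in_flip (inj_eq inl_inj).
  by have [->|_] := eqVneq l i; rewrite ?nim ?andbT ?addbF.
by rewrite !in_pendant_inr ey in_flip mx eq_sym (negPf nim).
Qed.

Lemma pendant_flip_inr x y : f y = flip (f x) m ->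
  pendant_code y = flip (pendant_code x) (inr (j \in f x)).
Proof.
move=> ey; apply/setP=> -[l|c]; rewrite in_flip.
  rewrite !in_pendant_inl ey in_flip /= addbF.
  by have [->|_] := eqVneq l m; rewrite ?andbF ?addbF.
rewrite !in_pendant_inr ey !in_flip eqxx [j == m]eq_sym (negPf nmj) addbF.
by rewrite (inj_eq inr_inj); case: (m \in f x) (j \in f x) c => [] [] [].
Qed.

Lemma pendant_eq x y :
  m \in f x -> m \in f y -> (j \in f x) = (j \in f y) -> x = y.
Proof.
by move=> mx my e; apply: f_inj; rewrite (pendant_vertex mx) (pendant_vertex my) e.
Qed.

Lemma pendant_embedding : cube_embedding pendant_code.
Proof.
have vertex_at (X : {set T}) : m \notin X -> exists x, f x = X.
  by move=> mX; apply/f_image; apply: Or31.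
split=> x y.
  rewrite f_adj; split=> -[k e].
    have [ekm|nkm] := eqVneq k m; first by eexists; apply: pendant_flip_inr; rewrite -ekm.
    have [mx|mx] := boolP (m \in f x); last by exists (inl k); exact: pendant_flip_inl.
    have my : m \in f y by rewrite e in_flip mx eq_sym (negPf nkm).
    have := pendant_second_bit my; rewrite e !in_flip (pendant_second_bit mx).
    have ny : j \in f y != (j \in f x).
      apply/eqP=> ejy; have exy : x = y by apply: pendant_eq.
      by have := flip_neq (f x) k; rewrite -e exy eqxx.
    move: ny; rewrite e in_flip; have [ejk _|_] := eqVneq j k; last by rewrite addbF eqxx.
    by rewrite -ejk eq_sym (negPf njj') addbF; case: (j \in f x).
  have emem i : i != m -> (i \in f y) = (i \in f x) (+) (inl i == k).
    move=> nim; have := in_pendant_inl y i; rewrite e in_flip in_pendant_inl.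
    by rewrite nim !andbT => ->.
  have etag c : (m \in f y) && ((j \in f y) == c) =
                ((m \in f x) && ((j \in f x) == c)) (+) (inr c == k).
    by have := in_pendant_inr y c; rewrite e in_flip in_pendant_inr => ->.
  case: k e emem etag => [i|c] e emem etag.
    have nim : i != m.
      have := in_pendant_inl y i; rewrite e in_flip in_pendant_inl eqxx.
      by case: eqP => // ->; rewrite !andbF.
    have [mx|mx] := boolP (m \in f x).
      have /andP[my /eqP ej] : (m \in f y) && ((j \in f y) == (j \in f x)).
        by rewrite etag mx eqxx addbF.
      have exy : x = y by apply: pendant_eq.
      by have := flip_neq (pendant_code x) (inl i); rewrite -e exy eqxx.
    exists i; apply/setP=> l; rewrite in_flip.
    have [->|nlm] := eqVneq l m; last by rewrite emem // (inj_eq inl_inj).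
    rewrite (negPf mx) eq_sym (negPf nim).
    by have := etag (j \in f y); rewrite (negPf mx) eqxx andbT.
  exists m; apply/setP=> l; rewrite in_flip.
  have [->|nlm] := eqVneq l m; last by rewrite emem // addbF.
  have := etag true; have := etag false; rewrite !(inj_eq inr_inj).
  by case: (m \in f y) (m \in f x) (j \in f y) (j \in f x) c {e etag emem} => [] [] [] [] [].
move=> nxy; have [mx|mx] := boolP (m \in f x).
  have [|x' ex'] := vertex_at (flip (f x) m); first by rewrite in_flip mx eqxx.
  exists (inr (j \in f x)), x'; split; last exact: pendant_flip_inr.
  rewrite in_symd !in_pendant_inr mx eqxx /=; apply/negP=> /andP[my /eqP ej].
  by rewrite (@pendant_eq x y) ?eqxx in nxy.
have [exy|/symdNeq[i]] := eqVneq (f x) (f y :\ m).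
  have my : m \in f y.
    apply: contraNT nxy => my; apply/eqP/f_inj; rewrite exy.
    by apply/setP=> l; rewrite !inE; case: eqP => // ->; rewrite (negPf my).
  exists (inr (j \in f x)), y; split; last first.
    by apply: pendant_flip_inr; rewrite exy -flip_rem // flipK.
  by rewrite in_symd !in_pendant_inr (negPf mx) my exy !inE eq_sym nmj eqxx.
rewrite in_symd !inE => ixy.
have nim : i != m by apply: contraTneq ixy => ->; rewrite eqxx (negPf mx).
have [|x' ex'] := vertex_at (flip (f x) i).
  by rewrite in_flip eq_sym (negPf nim) addbF.
exists (inl i), x'; split; last exact: pendant_flip_inl.
by move: ixy; rewrite in_symd !in_pendant_inl nim !andbT.
Qed.

Let c_ex : exists x, f x = [set j; m].
Proof. by apply/f_image; apply: Or32. Qed.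
Let d_ex : exists x, f x = [set j'; m].
Proof. by apply/f_image; apply: Or33. Qed.

Lemma pendant_partial_cube : partial_cube G.
Proof.
apply: (embedding_partial_cube pendant_embedding).
by case: c_ex => x _; apply/card_gt0P; exists x.
Qed.

(** A pendant bit determines bit [j], so flipping [j] at either pendant vertex
    leaves the graph. *)
Lemma pendant_not_daisy : ~ daisy_cube G.
Proof.
case: c_ex d_ex => x ex [y ey].
have jm : j == m = false by rewrite eq_sym (negPf nmj).
have j'j : j == j' = false by rewrite (negPf njj').
have absent z c : inr c \in pendant_code z -> (inl j \in pendant_code z) = c.
  by rewrite in_pendant_inr in_pendant_inl jm andbT => /andP[_ /eqP].
have x1 : inr true \in pendant_code x by rewrite in_pendant_inr ex !inE !eqxx orbT.
have y0 : inr false \in pendant_code y.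
  by rewrite in_pendant_inr ey !inE eqxx orbT j'j jm.
apply: (@not_daisy _ _ _ (flip (pendant_code x) (inl j)) (flip (pendant_code y) (inl j))
         (inl j) pendant_embedding).
- by rewrite in_symd !in_flip (absent _ _ x1) (absent _ _ y0) eqxx.
- move=> z /setP e; have := absent z true.
  by rewrite !e !in_flip x1 (absent _ _ x1) eqxx => /(_ isT).
- move=> z /setP e; have := absent z false.
  by rewrite !e !in_flip y0 (absent _ _ y0) eqxx => /(_ isT).
- by exists x; rewrite flipK.
by exists y; rewrite flipK.
Qed.

(** Bit [j'] may be forgotten: bit [j] alone still obstructs. *)
Lemma pendant_contraction :
  exists u v : G, [/\ adj u v, #|contraction u v| < #|G| &
                     ~ daisy_cube (contraction u v)].
Proof.
have [u eu] : exists u, f u = set0 by apply/f_image; apply: Or31; rewrite inE.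
have [v ev] : exists v, f v = flip (f u) j'.
  by apply/f_image; apply: Or31; rewrite in_flip eu inE.
have euv : pendant_code v = flip (pendant_code u) (inl j').
  by apply: pendant_flip_inl; rewrite // 1?eq_sym // eu inE.
exists u, v; split; first by apply/f_adj; exists j'.
  exact: (contraction_small pendant_embedding euv).
have img := contraction_image pendant_embedding euv.
case: c_ex d_ex => x ex [y ey].
have jm : j == m = false by rewrite eq_sym (negPf nmj).
have j'j : j == j' = false by rewrite (negPf njj').
pose f' z := pendant_code z :\ inl j'.
have absent z c : inr c \in f' z -> (inl j \in f' z) = c.
  rewrite !in_setD1 in_pendant_inr in_pendant_inl jm andbT.
  by rewrite (inj_eq inl_inj) j'j => /andP[_ /andP[_ /eqP]].
have x1 : inr true \in f' x by rewrite in_setD1 in_pendant_inr ex !inE !eqxx orbT.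
have y0 : inr false \in f' y.
  by rewrite in_setD1 in_pendant_inr ey !inE eqxx orbT j'j jm.
apply: (@not_daisy _ _ _ (flip (f' x) (inl j)) (flip (f' y) (inl j))
         (inl j) (contraction_embedding pendant_embedding euv)).
- by rewrite in_symd !in_flip (absent _ _ x1) (absent _ _ y0) eqxx.
- move=> C eC; have [z /setP e] := proj1 (img _) (ex_intro _ C eC).
  have := absent z true.
  by rewrite !e !in_flip x1 (absent _ _ x1) eqxx => /(_ isT).
- move=> C eC; have [z /setP e] := proj1 (img _) (ex_intro _ C eC).
  have := absent z false.
  by rewrite !e !in_flip y0 (absent _ _ y0) eqxx => /(_ isT).
- by rewrite flipK; apply/img; exists x.
by rewrite flipK; apply/img; exists y.
Qed.

End Pendants.

(** * Corners differing in exactly two binary coordinates *)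

(** Opposite edges of a square flip the same bit. *)
Lemma embedding_square (G : graph) (T : finType) (g : G -> {set T}) x y z w :
  cube_embedding g -> adj x y -> adj x z -> adj y w -> adj z w ->
  y != z -> x != w -> symd (g x) (g y) = symd (g z) (g w).
Proof.
move=> emb; have inj := inj_eq (embedding_inj emb).
move=> /(proj1 emb)[k ek] /(proj1 emb)[l el] /(proj1 emb)[k' ek'] /(proj1 emb)[l' el'].
rewrite -!inj => nyz nxw.
have e : flip (flip (g x) k) k' = flip (flip (g x) l) l' by rewrite -ek -el -ek' -el'.
have nkl : k != l by apply: contraNneq nyz => ekl; rewrite ek el ekl.
have nkk' : k != k'.
  by apply: contraNneq nxw => ekk; rewrite ek' ek -ekk flipK.
have /setP/(_ k) := e; rewrite !in_flip eqxx (negPf nkl) (negPf nkk') !addbF.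
have [kl'|_] := eqVneq k l'; last by case: (k \in g x).
by move=> _; rewrite el' -kl' ek symdC symd_flipl [in RHS]symdC symd_flipl.
Qed.

(** The two corners now differ in exactly the binary bits [j] and [j'].  Bits
    other than these two belong to both corners or to none, so [code_a] has
    [#|code_a| - 2] bits in common with [code_b]. *)
Section Codim2.
Variables (r s : nat) (a b : Defs.B r s).
Hypotheses (corner_a : corner a) (corner_b : corner b).
Local Notation bit := ('I_r * bool + 'I_s)%type.
Local Notation H := (B_minus a b).
Local Notation code := (@code r s a b).
Local Notation code_a := (@code_a r s a).
Local Notation code_b := (@code_b r s a b).
Variables (j j' : 'I_s).
Hypotheses (njj' : j != j') (ejj' : symd code_a code_b = [set inr j; inr j']).

Let cA : corner_set code_a := corner_code_a corner_a.

Lemma in_code_b k : (k \in code_b) = [&& k \in code_a, k != inr j & k != inr j'].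
Proof.
have /setP/(_ k) := ejj'; rewrite in_symd in_set2.
case: eqVneq => [->|_]; first by rewrite inr_code_a; case: (_ \in _).
case: eqVneq => [->|_]; first by rewrite inr_code_a; case: (_ \in _).
by case: (k \in code_a) (k \in code_b) => [] [].
Qed.

Lemma adjacent_code (x y : H) k : code y = flip (code x) k -> adj x y.
Proof. by move=> e; apply/code_adj; exists k. Qed.

Section Isometric.
Variables (T : finType) (g : H -> {set T}).
Hypothesis emb : cube_embedding g.

Lemma code_square (x y z w : H) k l : k != l ->
  code y = flip (code x) k -> code z = flip (code x) l ->
  code w = flip (flip (code x) k) l -> symd (g x) (g y) = symd (g z) (g w).
Proof.
move=> nkl ey ez ew; apply: embedding_square => //.
- exact: adjacent_code ey.
- exact: adjacent_code ez.
- by apply: (@adjacent_code _ _ l); rewrite ew ey.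
- by apply: (@adjacent_code _ _ k); rewrite ew ez flipC.
- apply: contra_neq nkl => yz; apply: (@flip_inj _ (code x)); by rewrite -ey -ez yz.
apply/eqP=> xw; move/setP/(_ k): ew; rewrite xw !in_flip eqxx (negPf nkl).
by rewrite addbF; case: (k \in _).
Qed.

Lemma code_bE : code_b = flip (flip code_a (inr j')) (inr j).
Proof.
apply/setP=> k; rewrite in_code_b !in_flip.
have [->|_] := eqVneq k (inr j); first by rewrite inr_code_a (inj_eq inr_inj) (negPf njj').
have [->|_] := eqVneq k (inr j'); first by rewrite inr_code_a.
by rewrite !addbF !andbT.
Qed.

(** [C] and [D] are the two vertices adjacent to both [a] and [b] in the grid.
    All their common neighbours have been deleted, hence no embedding of the
    remaining graph puts them within distance two. *)
Lemma common_neighbours_not_close (C D : H) :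
  code C = flip code_a (inr j') -> code D = flip code_a (inr j) ->
  hamming (g C) (g D) <= 2 -> False.
Proof.
move=> eC eD le2.
have nj : flip code_a (inr j) <> flip code_a (inr j').
  by move/flip_inj => [] /eqP; apply/negP.
have stepE (x y : H) k : g y = flip (g x) k -> exists k, code y = flip (code x) k.
  by move=> e; apply/code_adj; exact: embedding_adj e.
have nCD : C != D by apply/eqP=> e; apply: nj; rewrite -eC -eD e.
have [k [w [kCD ew]]] := proj2 emb C D nCD.
have := hamming_flip (g C) (g D) k; rewrite kCD -ew /= => h1.
have [k0 ek0] := stepE _ _ _ ew; rewrite eC in ek0.
have [nka nkb] := code_missing w.
have nk0j' : k0 != inr j' by apply/eqP=> e; apply: nka; rewrite ek0 e flipK.
have nk0j : k0 != inr j by apply/eqP=> e; apply: nkb; rewrite ek0 e code_bE.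
have [ewD|nwD] := eqVneq w D.
  move: ek0; rewrite ewD eD => /setP/(_ k0); rewrite !in_flip eqxx.
  by rewrite (negPf nk0j) (negPf nk0j') !addbF; case: (k0 \in _).
have [k' [w' [kwD ew']]] := proj2 emb w D nwD.
have := hamming_flip (g w) (g D) k'; rewrite kwD -ew' /= => h2.
have w'D : w' = D.
  by apply: (embedding_inj emb); apply/eqP; rewrite -hamming_eq0; apply/eqP; lia.
have [k1 ek1] := stepE _ _ _ ew'; rewrite ek0 w'D eD in ek1.
have /setP/(_ k0) := ek1; rewrite !in_flip eqxx.
rewrite (negPf nk0j) (negPf nk0j') !addbF.
have [ek|_] := eqVneq k0 k1; last by rewrite addbF; case: (k0 \in _).
by move=> _; apply: nj; rewrite ek1 ek flipK.
Qed.

(** Two common bits [m] and [m'] make the graph fail to be a partial cube.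
    Removing [m] from [C] or from [D] flips the same bit of [g], as one sees by
    passing through squares below the level of [m']: from [C] to the set without
    [m'], across to the corner [a] without [m'], across to [D] without [m'], and
    up to [D].  So [C] and [D] have the same distance under [g] as the sets
    obtained by removing [m], which have a common neighbour. *)
Lemma no_two_common_bits : 3 < #|code_a| -> False.
Proof.
move=> gt3.
have [m [m' [ma m'a nmm' /andP[nmj nmj'] /andP[nm'j nm'j']]]] :
    exists m m', [/\ m \in code_a, m' \in code_a, m != m',
      (m != inr j) && (m != inr j') & (m' != inr j) && (m' != inr j')].
  have : 1 < #|code_b|.
    have e : code_b = code_a :\ inr j :\ inr j'.
      apply/setP=> k; rewrite in_code_b !in_setD1.
      by case: (k \in code_a) (k == inr j) (k == inr j') => [] [] [].
    move: gt3; rewrite e (cardsD1 (inr j) code_a) inr_code_a.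
    rewrite (cardsD1 (inr j') (_ :\ _)) in_setD1 inr_code_a.
    by rewrite (inj_eq inr_inj) eq_sym (negPf njj') /= !add1n.
  case/card_gt1P=> m [m' []]; rewrite !in_code_b => /and3P[? ? ?] /and3P[? ? ?] ?.
  by exists m, m'; split=> //; apply/andP.
(* The sixteen subsets of [code_a] that contain all bits but some of
   [j], [j'], [m], [m'], as recorded by four booleans. *)
pose S c d e f := [set k in code_a | [&& (k == inr j) ==> c, (k == inr j') ==> d,
                                        (k == m) ==> e & (k == m') ==> f]].
have nj'j : (inr j' == inr j :> bit) = false by rewrite (inj_eq inr_inj) eq_sym (negPf njj').
have njm : (inr j == m) = false by rewrite eq_sym (negPf nmj).
have nj'm : (inr j' == m) = false by rewrite eq_sym (negPf nmj').
have njm' : (inr j == m') = false by rewrite eq_sym (negPf nm'j).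
have nj'm' : (inr j' == m') = false by rewrite eq_sym (negPf nm'j').
have Sj c d e f : (inr j \in S c d e f) = c.
  by rewrite inE inr_code_a eqxx (inj_eq inr_inj) (negPf njj') njm njm' !andbT.
have Sj' c d e f : (inr j' \in S c d e f) = d.
  by rewrite inE inr_code_a eqxx nj'j nj'm nj'm' !andbT.
have Sm c d e f : (m \in S c d e f) = e.
  by rewrite inE ma eqxx (negPf nmj) (negPf nmj') (negPf nmm') andbT.
have Sm' c d e f : (m' \in S c d e f) = f.
  by rewrite inE m'a eqxx (negPf nm'j) (negPf nm'j') [m' == m]eq_sym (negPf nmm').
have vtx c d e f : (c != d) || ~~ (e && f) -> exists x, code x = S c d e f.
  move=> cdef; apply/code_image; split.
  - apply: grid_set_sub (corner_set_grid cA).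
    by apply/subsetP=> k; rewrite inE => /andP[].
  - move=> eS; have := Sj c d e f; have := Sj' c d e f; have := Sm c d e f.
    have := Sm' c d e f; rewrite eS !inr_code_a ma m'a.
    by move: cdef; do 4!(move=> + e0; rewrite -{}e0).
  move=> eS; have := Sj c d e f; have := Sj' c d e f; have := Sm c d e f.
  have := Sm' c d e f; rewrite eS !in_code_b !eqxx ma m'a nmj nmj' nm'j nm'j'.
  rewrite !andbF /=.
  by move: cdef; do 4!(move=> + e0; rewrite -{}e0).
have flipj c d e f : flip (S c d e f) (inr j) = S (~~ c) d e f.
  apply/setP=> k; rewrite in_flip; have [->|nk] := eqVneq k (inr j).
    by rewrite !Sj addbT.
  by rewrite addbF !inE (negPf nk).
have flipj' c d e f : flip (S c d e f) (inr j') = S c (~~ d) e f.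
  apply/setP=> k; rewrite in_flip; have [->|nk] := eqVneq k (inr j').
    by rewrite !Sj' addbT.
  by rewrite addbF !inE (negPf nk).
have flipm c d e f : flip (S c d e f) m = S c d (~~ e) f.
  apply/setP=> k; rewrite in_flip; have [->|nk] := eqVneq k m.
    by rewrite !Sm addbT.
  by rewrite addbF !inE (negPf nk).
have flipm' c d e f : flip (S c d e f) m' = S c d e (~~ f).
  apply/setP=> k; rewrite in_flip; have [->|nk] := eqVneq k m'.
    by rewrite !Sm' addbT.
  by rewrite addbF !inE (negPf nk).
(* [C], [A], [D] stand for the values of [j] and [j'], and the subscripts for the
   bits among [m], [m'] that have been removed. *)
have [C eC] := vtx true false true true isT.
have [Cm eCm] := vtx true false false true isT.
have [Cm' eCm'] := vtx true false true false isT.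
have [Cmm' eCmm'] := vtx true false false false isT.
have [Am eAm] := vtx true true false true isT.
have [Am' eAm'] := vtx true true true false isT.
have [Amm' eAmm'] := vtx true true false false isT.
have [D eD] := vtx false true true true isT.
have [Dm eDm] := vtx false true false true isT.
have [Dm' eDm'] := vtx false true true false isT.
have [Dmm' eDmm'] := vtx false true false false isT.
have l1 : symd (g C) (g Cm) = symd (g Cm') (g Cmm').
  by apply: (@code_square _ _ _ _ m m'); rewrite ?eC ?eCm ?eCm' ?eCmm' ?flipm ?flipm'.
have l2 : symd (g Cm') (g Cmm') = symd (g Am') (g Amm').
  by apply: (@code_square _ _ _ _ m (inr j')); rewrite ?eCm' ?eCmm' ?eAm' ?eAmm' ?flipm ?flipj'.
have l3 : symd (g Am') (g Amm') = symd (g Dm') (g Dmm').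
  by apply: (@code_square _ _ _ _ m (inr j)); rewrite ?eDm' ?eDmm' ?eAm' ?eAmm' ?flipm ?flipj.
have l4 : symd (g Dm') (g Dmm') = symd (g D) (g Dm).
  by apply: (@code_square _ _ _ _ m m'); rewrite ?eD ?eDm ?eDm' ?eDmm' ?flipm ?flipm'.
have le2 : hamming (g C) (g D) <= 2.
  have -> : hamming (g C) (g D) = hamming (g Cm) (g Dm).
    by rewrite /hamming (symd_swap (B := g Cm) (D := g Dm)) // l1 l2 l3 l4.
  apply: (@embedding_path _ _ _ emb Cm [:: Am; Dm]); apply/and3P; split=> //.
    by apply: (@adjacent_code _ _ (inr j')); rewrite eCm eAm flipj'.
  by apply: (@adjacent_code _ _ (inr j)); rewrite eDm eAm flipj.
have eA : S true true true true = code_a.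
  by apply/setP=> k; rewrite [LHS]inE !implybT !andbT.
by apply: (common_neighbours_not_close _ _ le2); rewrite ?eC ?eD -eA ?flipj ?flipj'.
Qed.

(** Without a common bit the graph is a four-cycle minus two opposite vertices,
    which is disconnected. *)
Lemma some_common_bit : #|code_a| <= 2 -> False.
Proof.
move=> le2.
have sA k : k \in code_a -> (k == inr j) || (k == inr j').
  have s2 : [set inr j; inr j'] \subset code_a.
    by apply/subsetP=> l; rewrite in_set2 => /orP[]/eqP->; exact: inr_code_a.
  have/eqP <- : [set inr j; inr j'] == code_a.
    by rewrite eqEcard s2 cards2 (inj_eq inr_inj) njj'.
  by rewrite in_set2.
have all2 (k : bit) : (k == inr j) || (k == inr j').
  case: k => [[i c]|l]; last exact/sA/inr_code_a.
  by have [c' /sA] := corner_side i cA.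
have nAj' : exists x, code x = flip code_a (inr j').
  apply/code_image; split; first 1 last.
  - exact/eqP/flip_neq.
  - by rewrite code_bE => /eqP; rewrite eq_sym (negPf (flip_neq _ _)).
  apply: grid_set_flip => //; exact: corner_set_grid cA.
have nAj : exists x, code x = flip code_a (inr j).
  apply/code_image; split; first 1 last.
  - exact/eqP/flip_neq.
  - by rewrite code_bE flipC => /eqP; rewrite eq_sym (negPf (flip_neq _ _)).
  apply: grid_set_flip => //; exact: corner_set_grid cA.
case: nAj' nAj => C eC [D eD].
have nCD : C != D.
  apply: contra_neq njj' => e; have := eC; rewrite e eD => /flip_inj; by case.
have [k [w [_ /(embedding_adj emb)/code_adj[l]]]] := proj2 emb C D nCD.
have [nwa nwb] := code_missing w; rewrite eC => ew.
case/orP: (all2 l) => /eqP el; first by apply: nwb; rewrite ew el code_bE.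
by apply: nwa; rewrite ew el flipK.
Qed.
End Isometric.

(** With one common bit [m], a grid set containing [m] lies below [code_a]: an
    end bit outside [code_a] excludes the opposite end bit, which is in [code_a]
    and can only be [m]. *)
Lemma code_pendants : #|code_a| = 3 -> exists m, [/\ m != inr j, m != inr j' &
  forall X, (exists x, code x = X) <->
    [\/ m \notin X, X = [set inr j; m] | X = [set inr j'; m]]].
Proof.
move=> e3.
have [m em] : exists m, code_b = [set m].
  apply/cards1P/eqP.
  have e : code_b = code_a :\ inr j :\ inr j'.
    apply/setP=> k; rewrite in_code_b !in_setD1.
    by case: (k \in code_a) (k == inr j) (k == inr j') => [] [] [].
  move: e3; rewrite e (cardsD1 (inr j) code_a) inr_code_a.
  rewrite (cardsD1 (inr j') (_ :\ _)) in_setD1 inr_code_a.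
  by rewrite (inj_eq inr_inj) eq_sym (negPf njj') /= !add1n => -[].
have /and3P[ma nmj nmj'] : [&& m \in code_a, m != inr j & m != inr j'].
  by rewrite -in_code_b em in_set1.
have inA k : (k \in code_a) = [|| k == inr j, k == inr j' | k == m].
  have := in_code_b k; rewrite em in_set1 => ->.
  case: (eqVneq k (inr j)) => [->|_]; first exact: inr_code_a.
  by case: (eqVneq k (inr j')) => [->|_]; [exact: inr_code_a | rewrite !andbT].
exists m; split=> // X; rewrite code_image //; split.
  case=> gX nA nB; have [mX|mX] := boolP (m \in X); last exact: Or31.
  have XA k : k \in X -> k \in code_a.
    case: k => [[i c]|l] kX; last exact: inr_code_a.
    apply: contraT => kA; have := corner_other i c cA; rewrite kA inA /= => /eqP km.
    by have := gX i; move: mX kX; rewrite -km; case: (c) => /= -> ->.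
  have nj'j : (inr j' == inr j :> bit) = false by rewrite (inj_eq inr_inj) eq_sym (negPf njj').
  have [jX|jX] := boolP (inr j \in X); have [j'X|j'X] := boolP (inr j' \in X).
  - case: nA; apply/setP=> k; apply/idP/idP=> [/XA//|].
    by rewrite inA => /or3P[]/eqP->.
  - apply: Or32; apply/setP=> k; rewrite in_set2; apply/idP/orP=> [kX|[]/eqP->//].
    have := XA k kX; rewrite inA => /or3P[|/eqP ek|]; [by left| |by right].
    by rewrite -ek kX in j'X.
  - apply: Or33; apply/setP=> k; rewrite in_set2; apply/idP/orP=> [kX|[]/eqP->//].
    have := XA k kX; rewrite inA => /or3P[/eqP ek| |]; [|by left|by right].
    by rewrite -ek kX in jX.
  case: nB; rewrite em; apply/setP=> k; rewrite in_set1; apply/idP/eqP=> [kX|->//].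
  have := XA k kX; rewrite inA => /or3P[]/eqP // ek.
    by rewrite -ek kX in jX.
  by rewrite -ek kX in j'X.
have pair (l : 'I_s) l' : X = [set inr l; m] -> inr l' \notin X ->
    l = j \/ l = j' -> [/\ grid_set X, X <> code_a & X <> code_b].
  move=> eX nl' ll; split.
  - apply: grid_set_sub (corner_set_grid cA); apply/subsetP=> k.
    by rewrite eX in_set2 => /orP[]/eqP-> //; exact: inr_code_a.
  - by move=> e; rewrite e inr_code_a in nl'.
  move=> e; have : inr l \in code_b by rewrite -e eX in_set2 eqxx.
  by rewrite in_code_b; case: ll => ->; rewrite eqxx ?andbF.
case=> [nm|eX|eX].
- split; last 2 first.
  + by move=> e; rewrite e ma in nm.
  + by move=> e; rewrite e em in_set1 eqxx in nm.
  move=> i; apply/negP=> /andP[tX fX].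
  have [c /[dup] icA] := corner_side i cA; rewrite inA /= => /eqP ic.
  by move: nm; rewrite -ic; case: c {icA ic} => /=; rewrite ?tX ?fX.
- apply: (pair j j') => //; last by left.
  by rewrite eX in_set2 [_ == m]eq_sym (negPf nmj') (inj_eq inr_inj) eq_sym (negPf njj').
apply: (pair j' j) => //; last by right.
by rewrite eX in_set2 [_ == m]eq_sym (negPf nmj) (inj_eq inr_inj) (negPf njj').
Qed.

End Codim2.

(** * Minimality *)

(** A slice of the grid, obtained by fixing the bit [k], is daisy even when the
    corner [C] is deleted.  The base [Z] is chosen with the middle value at all
    ternary coordinates and binary bits opposite to those of [C], apart from bit
    [k]; so a step into [C] never moves towards [Z]. *)
Lemma corner_slice_daisy (r s : nat) (K : graph)
    (f : K -> {set 'I_r * bool + 'I_s}) C k c :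
  cube_embedding f -> 0 < #|K| -> corner_set C ->
  (forall x, grid_set (f x) /\ (k \in f x) = c) ->
  (forall X, grid_set X -> (k \in X) = c -> X <> C -> exists x, f x = X) ->
  daisy_cube K.
Proof.
move=> emb K0 cC sub sup.
pose Z := [set z | if z == k then c else
                   if z is inr _ then z \notin C else false].
have kZ : (k \in Z) = c by rewrite inE eqxx.
apply: (embedding_daisy (Z := Z) emb K0) => x l.
have [gx kx] := sub x; rewrite in_symd => lxZ.
have nlk : l != k by apply: contraTneq lxZ => ->; rewrite kx kZ addbb.
apply: sup; last 1 first.
- move: lxZ; rewrite inE (negPf nlk); case: l nlk => [ib|j] _.
    rewrite addbF => lx e; by have [? []] := flip_to_corner cC gx lx e.
  move=> lxC e; move: lxC; rewrite -e in_flip eqxx.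
  by case: (_ \in _).
- move: lxZ; rewrite [l \in Z]inE (negPf nlk); case: l nlk => [ib|j] _.
    by rewrite addbF => lx; apply: grid_set_sub gx; rewrite flip_rem // subsetDl.
  by move=> _; apply: grid_set_flip.
by rewrite in_flip eq_sym (negPf nlk) addbF.
Qed.

Section Main.
Variables (r s : nat) (a b : Defs.B r s).
Hypotheses (corner_a : corner a) (corner_b : corner b).
Local Notation bit := ('I_r * bool + 'I_s)%type.
Local Notation H := (B_minus a b).
Local Notation p := (p_corners a b).
Local Notation q := (q_corners a b).
Local Notation code := (@code r s a b).
Local Notation code_a := (@code_a r s a).
Local Notation code_b := (@code_b r s a b).

(** Opposite corners differ on all bits, so fixing or forgetting a bit [k] leaves
    a slice of the grid from which at most one corner is missing: if [k] is fixed,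
    the other corner is outside the slice; if [k] is forgotten, a set without [k]
    is its own image, so only the corner without [k] can be lost.  Further minors
    remain daisy because daisy cubes are closed under minors. *)
Lemma opposite_minors : opposite a b -> cube_embedding code ->
  forall K, pc_minor H K -> iso K H \/ daisy_cube K.
Proof.
move=> /(opposite_symd corner_a corner_b) opp emb.
have bitC k : (k \in code_b) = (k \notin code_a).
  have /setP/(_ k) := opp; rewrite in_symd in_setT.
  by case: (k \in code_a) (k \in code_b) => [] [].
have corner_with k c : exists C, [/\ corner_set C, (k \in C) = c &
    forall X, grid_set X -> (k \in X) = c -> X <> C -> exists x, code x = X].
  have [ka|nka] := eqVneq (k \in code_a) c.
    exists code_a; split=> //; first exact: corner_code_a.
    move=> X gX kX nX; apply/code_image; split=> // e.
    by move: kX; rewrite e bitC ka; case: (c).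
  exists code_b; split=> [||X gX kX nX]; first exact: corner_code_b.
    by rewrite bitC; move: nka; case: (_ \in _) (c) => [] [].
  apply/code_image; split=> // e.
  by move: nka; rewrite -kX e eqxx.
move=> K; elim=> [|{}K u v _ IH auv|{}K u v _ IH auv].
- by left; exists id; split=> //; exists id.
- right; case: IH => [[phi [bphi adjphi]]|dK]; last exact: restriction_daisy.
  have femb := embedding_iso emb bphi adjphi.
  have [k euv] := proj1 (proj1 femb u v) auv.
  have img := restriction_image femb euv.
  have [C [cC kC full]] := corner_with k (k \in code (phi u)).
  apply: (corner_slice_daisy (k := k) (c := k \in code (phi u))
            (restriction_embedding femb euv) _ cC).
  + have [z _] := proj2 (img _) (ex_intro2 _ _ u erefl erefl).
    by apply/card_gt0P; exists z.
  + move=> z; split; first exact: grid_code_set.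
    by have [x /= ex] := proj1 (img _) (ex_intro _ z erefl).
  move=> X gX kX nX; apply/img; have [x ex] := full X gX kX nX.
  by case: bphi => phi' _ phiK; exists (phi' x); rewrite //= phiK.
right; case: IH => [[phi [bphi adjphi]]|dK]; last exact: contraction_daisy.
have femb := embedding_iso emb bphi adjphi.
have [k euv] := proj1 (proj1 femb u v) auv.
have img := contraction_image femb euv.
have [C [cC kC full]] := corner_with k false.
apply: (corner_slice_daisy (k := k) (c := false) (contraction_embedding femb euv) _ cC).
+ by have [z _] := proj2 (img _) (ex_intro _ u erefl); apply/card_gt0P; exists z.
+ move=> z; have [x <-] := proj1 (img _) (ex_intro _ z erefl).
  split; last by rewrite !inE eqxx.
  apply: (@grid_set_sub _ _ _ (code (phi x))); first exact: subD1set.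
  exact: grid_code_set.
move=> X gX kX nX; apply/img; have [x ex] := full X gX kX nX.
case: bphi => phi' _ phiK; exists (phi' x); rewrite /= phiK ex.
by apply/setP=> l; rewrite in_setD1; case: eqP => // ->; rewrite kX.
Qed.

(** If the corners have a bit [k] in common, fixing it yields a smaller graph
    with the same obstruction. *)
Lemma nonopposite_minor : ~ opposite a b -> cube_embedding code ->
  q <> 0 -> ~ (p = 0 /\ q = 1) ->
  exists u v : H, adj u v /\ ~ daisy_cube (restriction u v).
Proof.
move=> nopp emb q0 npq; have [j jab] := q_corners_neq0 q0.
have cA : corner_set code_a by exact: corner_code_a.
have cB : corner_set code_b by exact: corner_code_b.
have [k [ka kb]] : exists k, k \in code_a /\ k \in code_b.
  have : ~~ [forall k, k \in symd code_a code_b].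
    apply/negP=> /forallP all; apply: nopp; apply/opposite_symd => //.
    by apply/setP=> k; rewrite in_setT all.
  rewrite negb_forall => /existsP[k]; rewrite in_symd negb_add => /eqP eab.
  have [ka|ka] := boolP (k \in code_a); first by exists k; rewrite -eab.
  case: k eab ka => [[i c]|l] eab ka; last by rewrite inr_code_a in ka.
  exists (inl (i, ~~ c)).
  by rewrite (corner_other _ _ cA) (corner_other _ _ cB) -eab.
have nkj : k != inr j.
  by apply: contraTneq jab => <-; rewrite in_symd ka kb.
have [u eu] : exists u, code u = flip code_a (inr j).
  by apply: code_flip_image => //; left.
have [w ew] : exists w, code w = flip code_b (inr j).
  by apply: code_flip_image => //; right.
have [v ev] : exists v, code v = flip (code u) k.
  have kX : k \notin flip (flip code_a (inr j)) k.
    by rewrite !in_flip ka eqxx (negPf nkj).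
  rewrite eu; apply/code_image; split.
  - rewrite flipC; apply: grid_set_flip => //.
    by apply: grid_set_sub (corner_set_grid cA); rewrite flip_rem // subsetDl.
  - by move=> e; rewrite e ka in kX.
  by move=> e; rewrite e kb in kX.
have img := restriction_image emb ev.
have ku : k \in code u by rewrite eu in_flip ka (negPf nkj).
exists u, v; split; first by apply/code_adj; exists k.
apply: (not_daisy (restriction_embedding emb ev) jab).
- by move=> z; case: (code_missing (val z)).
- by move=> z; case: (code_missing (val z)).
- by apply/img; exists u; rewrite // -eu.
by apply/img; exists w; rewrite // ku in_flip kb (negPf nkj).
Qed.

End Main.

Lemma proper_minor_not_iso (G K : graph) : #|K| < #|G| -> ~ iso K G.
Proof. by move=> lt /iso_card e; rewrite e ltnn in lt. Qed.

Theorem theorem20 (r s : nat) (a b : B r s)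
    (corner_a : corner a) (corner_b : corner b) (neq_ab : a <> b)
    (H_nonempty : 0 < #|B_minus a b|) :
  let H := B_minus a b in
  let p := p_corners a b in
  let q := q_corners a b in
  [/\ partial_cube H <->
        ((p, q) <> (0, 2) \/ ((p, q) = (0, 2) /\ r + s = 3)),
      partial_cube H -> (daisy_cube H <-> (q = 0 \/ (p, q) = (0, 1)))
    & minimal_forbidden H <-> (opposite a b /\ 1 <= s /\ 3 <= 2 * r + s)].
Proof.
move=> H p q.
have pairE m n : (p, q) = (m, n) <-> p = m /\ q = n by split=> [[-> ->]|[-> ->]].
have isometric_case : (p, q) <> (0, 2) -> cube_embedding (@code r s a b).
  by move=> npq; apply: code_embedding => // pq; apply/npq/pairE.
have codim2 : (p, q) = (0, 2) -> exists j j', j != j' /\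
    symd (code_a a) (@code_b r s a b) = [set inr j; inr j'].
  by move/pairE/(corners_differ_on_pair corner_a corner_b).
have [pq|npq] := eqVneq (p, q) (0, 2).
  have [j [j' [njj' ejj']]] := codim2 pq.
  have dim3 : partial_cube H -> r + s = 3.
    case/partial_cube_embedding=> n [g gemb].
    have [lt3|gt3|//] := ltngtP (r + s) 3; exfalso.
      apply: (some_common_bit corner_a njj' ejj' gemb).
      by rewrite card_code_a // -ltnS.
    by apply: (no_two_common_bits corner_a njj' ejj' gemb); rewrite card_code_a.
  have pendants : r + s = 3 -> [/\ partial_cube H, ~ daisy_cube H &
      exists u v : H, [/\ adj u v, #|contraction u v| < #|H| &
                          ~ daisy_cube (contraction u v)]].
    move=> rs3; have [|m [nmj nmj' img]] := code_pendants corner_a njj' ejj'.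
      by rewrite card_code_a.
    have inj := @code_inj r s a b; have cadj := @code_adj r s a b.
    have njj2 : inr j != inr j' :> 'I_r * bool + 'I_s by rewrite (inj_eq inr_inj).
    split.
    - exact: (pendant_partial_cube inj cadj njj2 nmj nmj' img).
    - exact: (pendant_not_daisy inj cadj njj2 nmj nmj' img).
    exact: (pendant_contraction inj cadj njj2 nmj nmj' img).
  have [p0 q2] := proj1 (pairE _ _) pq.
  split.
  - split=> [/dim3|[]]; [by right | by rewrite pq | by case=> _ /pendants[]].
  - move=> /dim3/pendants[_ nd _]; split=> // -[q0|/pairE[_ q1]].
      by rewrite q0 in q2.
    by rewrite q1 in q2.
  split=> [[/dim3/pendants[_ _ [u [v [auv small nd]]]] _ minors]|].
    case: nd; apply: minors.
      exact: pc_minor_contraction (pc_minor_refl H) auv.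
    exact: proper_minor_not_iso small.
  by case=> -[]; rewrite -/p -/q p0 q2 => <- <- [].
have emb : cube_embedding (@code r s a b) by apply: isometric_case; exact/eqP.
have pcH : partial_cube H by exact: embedding_partial_cube emb H_nonempty.
have daisyE : daisy_cube H <-> (q = 0 \/ (p, q) = (0, 1)).
  split=> [dH|[q0|/pairE pq]]; last 2 first.
  - by apply: code_daisy emb H_nonempty _ => //; left.
  - by apply: code_daisy emb H_nonempty _ => //; right.
  have [|/eqP q0] := eqVneq q 0; first by left.
  have [|/eqP pq1] := eqVneq (p, q) (0, 1); first by right.
  by case: (code_not_daisy corner_a corner_b emb q0 _ dH) => /pairE.
split.
- by split=> // _; left; exact/eqP.
- by [].
split=> [[_ nd minors]|[opp [s1 rs3]]].
  have q0 : q <> 0 by move=> q0; apply/nd/daisyE; left.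
  have npq1 : ~ (p = 0 /\ q = 1) by move/pairE=> e; apply/nd/daisyE; right.
  have opp : opposite a b.
    have [//|nopp] := boolP ((p_corners a b == r) && (q_corners a b == s)).
      by case/andP=> /eqP ? /eqP ?.
    have [|u [v [auv nd']]] := nonopposite_minor corner_a corner_b _ emb q0 npq1.
      by case=> e1 e2; rewrite e1 e2 !eqxx in nopp.
    case: nd'; apply: minors.
      exact: pc_minor_restriction (pc_minor_refl H) auv.
    have [k euv] := proj1 (proj1 emb u v) auv.
    exact: proper_minor_not_iso (restriction_small emb euv).
  split=> //; case: opp => ep eq.
  have npq2 : ~ (p = 0 /\ q = 2) by move/pairE/eqP; apply/negP.
  by rewrite -/p -/q in ep eq; rewrite -ep -eq; lia.
have [ep eq] := opp; rewrite -/p -/q in ep eq.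
have ndH : ~ daisy_cube H.
  by move/daisyE=> [|/pairE[]]; rewrite ?ep ?eq; lia.
split=> // K HK nKH.
by case: (opposite_minors corner_a corner_b opp emb HK).
Qed.
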